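(* The following conditions are equivalent: (1) $\mathfrak b=\omega_1$; (2) there exists an uncountable $\mathbb Q$-concentrated set in the real line; (3) there exists an uncountable $\mathcal K$-Lusin set; (4) for every ordinal $\lambda$ with $2\le\lambda<\omega_2$, $\mathrm{cf}(\lambda)\le\omega$ and $\mathrm{cf}(\lim\lambda)\le\omega_1$ there exists an uncountable FLS space of scattered height $\lambda$; (5) there exists an uncountable FLS space of finite scattered height; (6) there exists an FLS space $X$ such that the scattered height $\hbar[X]$ of $X$ satisfies $\mathrm{cf}(\lim\hbar[X])=\omega_1$; (7) there exists a semiregular uncountable FLS space of scattered height $2$.
   Context: For $f,g\in\omega^\omega$, $f\le^* g$ means $f(n)\le g(n)$ for all but finitely many $n$. $\mathfrak b$ is the least cardinality of a subset $B\subseteq\omega^\omega$ for which there is no $g\in\omega^\omega$ with $f\le^* g$ for all $f\in B$. $\omega^\omega$ carries the product topology ($\omega$ discrete). A $\mathcal K$-Lusin set is a set $L\subseteq\omega^\omega$ such that $K\cap L$ is countable for every compact $K\subseteq\omega^\omega$. A set $A\subseteq\mathbb R$ is $\mathbb Q$-concentrated if $A\setminus U$ is countable for every open $U\subseteq\mathbb R$ containing $\mathbb Q$. Every ordinal $\lambda$ is uniquely $\lambda=\mu+n$ with $\mu$ a limit ordinal ($0$ counts as limit) and $n\in\omega$; $\lim\lambda:=\mu$. $\mathrm{cf}$ is cofinality, with $\mathrm{cf}(0)=0$ and $\mathrm{cf}(\lambda)=1$ for successor $\lambda$. All spaces are Hausdorff topological spaces. For a space $X$, $X^{(1)}$ is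 the set of non-isolated points of $X$; $X^{(0)}=X$ and $X^{(\alpha)}=\bigcap_{\xi<\alpha}(X^{(\xi)})^{(1)}$ for $\alpha>0$. $X$ is scattered if every nonempty subspace has an isolated point; the scattered height $\hbar[X]$ of a scattered space $X$ is the smallest ordinal $\alpha$ with $X^{(\alpha)}=\emptyset$. An FLS space is a first-countable Lindelöf scattered (Hausdorff) space. A set is regular open if it equals the interior of its closure; a space is semiregular if its regular open sets form a base of its topology. *)

(* Defs.v *)
From mathcomp Require Import all_boot all_order all_algebra.
From mathcomp Require Import all_classical all_reals all_analysis.
From mathcomp Require Import wochoice.

Set Implicit Arguments.
Unset Strict Implicit.
Unset Printing Implicit Defensive.

Import numFieldNormedType.Exports.

Local Open Scope classical_set_scope.
Local Open Scope card_scope.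

Declare Scope Ord_scope.
Delimit Scope Ord_scope with Ord.
Local Open Scope Ord_scope.

(* An ordinal is represented by a well-ordered type; equality of ordinals is
   order isomorphism [=o], and not Leibniz equality. *)
Record Ord := MkOrd {
  Ord_car :> Type;
  Ole : rel Ord_car;
  Ole_wo : well_order Ole }.

Arguments Ole {o}.

Definition Olt (a : Ord) : rel a := fun x y => ~~ Ole y x.
Arguments Olt {a}.

Section well_order_facts.
Variables (T : Type) (R : rel T).

Lemma wo_total : well_order R -> total R.
Proof.
move=> wo x y.
have [|z [[/asboolP zxy zmin] _]] := wo [pred z | `[< z = x \/ z = y >]].
  by exists x; apply/asboolP; left.
have Rzx : R z x by apply: zmin; apply/asboolP; left.
have Rzy : R z y by apply: zmin; apply/asboolP; right.
by case: zxy => E; subst z; rewrite ?Rzx ?Rzy ?orbT.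
Qed.

Lemma wo_refl : well_order R -> reflexive R.
Proof. by move=> wo x; have := wo_total wo x x; rewrite orbb. Qed.

Lemma wo_anti : well_order R -> antisymmetric R.
Proof.
move=> wo x y /andP[Rxy Ryx].
have [|z [_ zuniq]] := wo [pred z | `[< z = x \/ z = y >]].
  by exists x; apply/asboolP; left.
rewrite -(zuniq x) ?(zuniq y)//.
- split; first by apply/asboolP; right.
  by move=> w /asboolP[]->//; exact: wo_refl.
- split; first by apply/asboolP; left.
  by move=> w /asboolP[]->//; exact: wo_refl.
Qed.

Lemma wo_wf : well_order R -> well_founded (fun x y => ~~ R y x).
Proof.
move=> wo x; apply: contrapT => nAx.
have [|z [[/asboolP nAz zmin] _]] :=
    wo [pred z | `[< ~ Acc (fun x y => ~~ R y x) z >]].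
  by exists x; apply/asboolP.
apply: nAz; constructor => y /negP nRzy; apply: contrapT => nAy.
by apply: nRzy; apply: zmin; apply/asboolP.
Qed.

Lemma wf_wo : total R -> antisymmetric R ->
  well_founded (fun x y => ~~ R y x) -> well_order R.
Proof.
move=> tot anti wf; apply: antisymmetric_well_order => // A [x].
elim/(well_founded_ind wf): x => x IH Ax.
have [[y Ay nRxy]|H] := pselect (exists2 y, y \in A & ~~ R x y).
  exact: IH nRxy Ay.
exists x; split=> // y Ay; apply: contrapT => /negP nRxy.
by apply: H; exists y.
Qed.

End well_order_facts.

Lemma Olt_wf (a : Ord) : well_founded (@Olt a).
Proof. exact/wo_wf/Ole_wo. Qed.

Lemma sub_well_order (T U : Type) (R : rel T) (f : U -> T) :
  injective f -> well_order R -> well_order (fun u v => R (f u) (f v)).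
Proof.
move=> finj wo; apply: wf_wo.
- by move=> x y; exact: wo_total.
- by move=> x y /(wo_anti wo)/finj.
- have H t : forall u, f u = t -> Acc (fun u v => ~~ R (f v) (f u)) u.
    elim/(well_founded_ind (wo_wf wo)): t => t IH u fu.
    by constructor => v; rewrite fu => vt; exact: IH vt _ _.
  by move=> u; exact: H.
Qed.

Lemma leq_well_order : well_order leq.
Proof.
apply: wf_wo; [exact: leq_total|exact: anti_leq|].
suff H m : forall n, (n < m)%N -> Acc (fun x y => ~~ (y <= x)%N) n.
  by move=> n; exact: (H n.+1).
elim: m => [//|m IH] n nm; constructor => k /negP kn; apply: IH.
by rewrite -ltnS; apply: leq_trans nm; rewrite ltnS ltnNge; exact/negP.
Qed.

Definition sum_le (a b : Ord) : rel (a + b) := fun u v =>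
  match u, v with
  | inl x, inl y => Ole x y
  | inl _, inr _ => true
  | inr _, inl _ => false
  | inr x, inr y => Ole x y
  end.

Lemma sum_le_well_order (a b : Ord) : well_order (@sum_le a b).
Proof.
have accl (x : a) : Acc (fun u v => ~~ sum_le v u) (inl x : a + b).
  elim/(well_founded_ind (@Olt_wf a)): x => x IH.
  by constructor => -[y /IH|y /negP/(_ isT)].
apply: wf_wo.
- by move=> [x|x] [y|y]//=; exact/wo_total/Ole_wo.
- by move=> [x|x] [y|y]//= /(wo_anti (@Ole_wo _))->.
- move=> [x|x]; first exact: accl.
  elim/(well_founded_ind (@Olt_wf b)): x => x IH.
  by constructor => -[y _|y /IH]; [exact: accl|].
Qed.

Definition Oseg (a : Ord) (x : a) : Ord :=
  MkOrd (sub_well_order (@val_inj _ _ {y : a | Olt y x}) (@Ole_wo a)).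

Definition Oadd (a b : Ord) : Ord := MkOrd (@sum_le_well_order a b).

Definition Onat (n : nat) : Ord :=
  MkOrd (sub_well_order (@ord_inj n) leq_well_order).

Definition omega : Ord := MkOrd leq_well_order.

Definition Oeq (a b : Ord) : Prop :=
  exists2 f : a -> b, bijective f & {mono f : x y / Ole x y}.
Notation "a =o b" := (Oeq a b) (at level 70) : Ord_scope.

Definition Ordlt (a b : Ord) : Prop := exists x : b, a =o Oseg x.
Notation "a <o b" := (Ordlt a b) (at level 70) : Ord_scope.

Definition Ordle (a b : Ord) : Prop := a <o b \/ a =o b.
Notation "a <=o b" := (Ordle a b) (at level 70) : Ord_scope.

(* The least ordinal satisfying P. The value when no ordinal satisfies P is
   immaterial. *)
Definition least_Ord (P : Ord -> Prop) : Ord :=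
  if pselect (exists a, P a /\ forall b, P b -> a <=o b) is left e
  then projT1 (cid e) else Onat 0.

(* No last element: 0 is a limit ordinal. *)
Definition limit_Ord (a : Ord) : Prop := forall x : a, exists y : a, Olt x y.

Definition lim_Ord (a : Ord) : Ord :=
  least_Ord (fun m => limit_Ord m /\ exists n, a =o Oadd m (Onat n)).

Definition cf (a : Ord) : Ord :=
  least_Ord (fun k => exists f : k -> a, forall x, exists i, Ole x (f i)).

(* Cardinals are initial ordinals. *)
Definition omega1 : Ord := least_Ord (fun k => ~ countable [set: k]).

Definition omega2 : Ord :=
  least_Ord (fun k => ~ ([set: k] #<= [set: omega1])).

Definition le_star (f g : nat -> nat) : Prop :=
  \forall n \near \oo, (f n <= g n)%N.

Definition unbounded_star (B : set (nat -> nat)) : Prop :=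
  ~ exists g, forall f, B f -> le_star f g.

Definition bounding_number : Ord :=
  least_Ord (fun k => exists2 B, unbounded_star B & B #= [set: k]).

Definition K_Lusin (L : set {ptws nat -> nat}) : Prop :=
  forall K : set {ptws nat -> nat}, compact K -> countable (K `&` L).

Definition Q_concentrated (R : realType) (A : set R) : Prop :=
  forall U : set R, open U -> range (@ratr R) `<=` U -> countable (A `\` U).

Section spaces.
Variable X : topologicalType.

Definition derived_set (A : set X) : set X := A `\` isolated A.

(* [CB_at x] is X^(xi) for xi the order type of the predecessors of x. *)
Definition CB_at (a : Ord) : a -> set X :=
  Fix (@Olt_wf a) (fun=> set X) (fun x CB_lt =>
    \bigcap_(y in [set: {y : a | Olt y x}]) derived_set (CB_lt (sval y) (svalP y))).

Definition CB (a : Ord) : set X :=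
  \bigcap_(x in [set: a]) derived_set (CB_at x).

Definition scattered : Prop :=
  forall A : set X, A !=set0 -> isolated A !=set0.

Definition scattered_height : Ord := least_Ord (fun a => CB a = set0).

Definition first_countable : Prop := forall x : X, exists B : set (set X),
  [/\ countable B, B `<=` nbhs x &
      forall V, nbhs x V -> exists2 U, B U & U `<=` V].

Definition lindelof : Prop := forall C : set (set X),
  C `<=` open -> \bigcup_(U in C) U = setT ->
  exists D : set (set X),
    [/\ D `<=` C, countable D & \bigcup_(U in D) U = setT].

Definition FLS : Prop :=
  [/\ hausdorff_space X, first_countable, lindelof & scattered].

Definition semiregular : Prop := basis (@regopen X).

End spaces.

Arguments CB_at X {a} x.
Arguments CB X a : clear implicits.

(* Main.v *)
Require Import Defs.
From HB Require Import structures.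
From mathcomp Require Import all_boot all_order all_algebra.
From mathcomp Require Import all_classical all_reals all_analysis.
From mathcomp Require Import wochoice lra.

Set Implicit Arguments.
Unset Strict Implicit.
Unset Printing Implicit Defensive.

Import Order.TTheory GRing.Theory Num.Theory numFieldNormedType.Exports.

Local Open Scope classical_set_scope.
Local Open Scope card_scope.
Local Open Scope Ord_scope.

(** All conditions turn out to be equivalent to the existence of a concentrated
    family: functions [f x : nat -> nat], indexed by [x : omega1], such that
    every [h : nat -> nat] is a pointwise upper bound of only countably many
    [f x] ([has_concentrated_family]).

    For the bounding number: from an unbounded family of size [omega1], taking
    at stage [x] an eventual upper bound of the functions up to [x] gives a
    concentrated family; conversely a concentrated family is unbounded, and
    countable families are always bounded. For Lusin sets: a subset of the
    Baire space is contained in a compact set iff it is pointwise bounded. All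
    other conditions produce a concentrated family through one lemma,
    [concentrated_around]: if uncountably many points of a first-countable
    Hausdorff space avoid a countable set [D], but each open set containing [D]
    contains all but countably many of them, then the indices of the basic
    neighbourhoods of the points of [D] that miss a given point form a
    concentrated family. For a concentrated set of reals, [D] is the set of
    rational numbers. For an uncountable space of finite height, [D] is the
    first countable set in the sequence of derived sets, and the points are
    those of the preceding set outside [D]. For a space whose height has a limit part [m] of
    cofinality [omega1], [D] is the [m]-th derived set [CB X m] (or the
    previous case applies), and one takes a point in each of [omega1] cofinal
    levels below [m]: by the Lindelof property, an open set containing [D]
    contains a whole level.

    Conversely, let a concentrated family be given. Adding up sparse ternary
    expansions maps it to a concentrated set of reals, because a number with a
    long run of 0s in its expansion is close to a rational number. To build spaces,
    each [f x] is viewed as a branch of the tree of finite sequences: it is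
    close to the node [s] if it passes through [s] and leaves it through a
    large value. Taking the nodes as additional points (hubs), and attaching to
    the branch [f x] an arbitrary space [Y x], gives a Hausdorff
    first-countable space in which every neighbourhood of the set of hubs
    contains all but countably many of the [Y x] (König's lemma); so it is
    Lindelof if the [Y x] are, although it has uncountably many summands. With
    one-point spaces [Y x] this gives height 2, and isolated points private to
    each hub make it semiregular. With spaces [Y x] whose heights tend to an
    ordinal of cofinality [omega1], it gives the crucial step of a recursion
    that constructs all heights below [omega2]; a single hub suffices at
    successors and at countable cofinality. *)

(** * Countable sets *)

Lemma countable_preimage (T U : Type) (f : T -> U) (A : set T) (B : set U) :
  (forall x y, A x -> A y -> f x = f y -> x = y) -> (forall x, A x -> B (f x)) ->
  countable B -> countable A.
Proof.
move=> finj fAB /countable_injP[g ginj]; apply/countable_injP.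
exists (g \o f) => x y /set_mem Ax /set_mem Ay /= /ginj gE.
by apply: finj => //; apply: gE; apply/mem_set/fAB.
Qed.

Lemma countable_fibers (T U : Type) (f : T -> U) (A : set T) :
  (forall y, countable (A `&` f @^-1` [set y])) -> countable (f @` A) ->
  countable A.
Proof.
move=> cfib cfA; suff -> : A = \bigcup_(y in f @` A) (A `&` f @^-1` [set y]).
  exact: bigcup_countable.
by apply/seteqP; split=> [x Ax|x [y _ []]//]; exists (f x) => //; exists x.
Qed.

Lemma countable_image (T U : Type) (f : T -> U) (A : set T) :
  countable A -> countable (f @` A).
Proof. exact/sub_countable/card_image_le. Qed.

Lemma countable_sub (T : Type) (A B : set T) :
  A `<=` B -> countable B -> countable A.
Proof. by move=> /subset_card_le; exact: sub_countable. Qed.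

Lemma countableU (T : Type) (A B : set T) :
  countable A -> countable B -> countable (A `|` B).
Proof.
by move=> cA cB; rewrite -bigcup2E; apply: bigcup_countable => // -[|[|]] /=.
Qed.

Lemma countable_sum (T U : Type) (A : set (T + U)) :
  countable (inl @^-1` A) -> countable (inr @^-1` A) -> countable A.
Proof.
move=> cl cr.
apply: (@countable_sub _ _ (inl @` (inl @^-1` A) `|` inr @` (inr @^-1` A))).
  by move=> [x|x] Ax; [left|right]; exists x.
by apply: countableU; exact: countable_image.
Qed.

(** * Well-orders and their comparison *)

Section order_facts.
Variable a : Ord.
Implicit Types x y z : a.

Lemma Ole_refl x : Ole x x. Proof. exact/wo_refl/Ole_wo. Qed.

Lemma Ole_total x y : Ole x y || Ole y x. Proof. exact/wo_total/Ole_wo. Qed.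

Lemma Ole_anti x y : Ole x y -> Ole y x -> x = y.
Proof. by move=> xy yx; apply: (wo_anti (@Ole_wo a)); rewrite xy yx. Qed.

Lemma Ole_min (P : a -> Prop) :
  (exists x, P x) -> exists x, P x /\ forall y, P y -> Ole x y.
Proof.
move=> [x Px]; have [|z [[/asboolP Pz zmin] _]] := @Ole_wo a [pred z | `[< P z >]].
  by exists x; apply/asboolP.
by exists z; split=> // y Py; apply: zmin; apply/asboolP.
Qed.

Lemma Ole_trans y x z : Ole x y -> Ole y z -> Ole x z.
Proof.
move=> xy yz; have [|w [wE wmin]] := @Ole_min [set x; y; z].
  by exists x; left; left.
have [wx wy wz] : [/\ Ole w x, Ole w y & Ole w z].
  by split; apply: wmin; [left; left|left; right|right].
case: wE => [[/= wE|/= wE]|/= wE]; rewrite wE in wx wy wz => //.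
- by rewrite (Ole_anti xy wx).
- by rewrite -(Ole_anti yz wy).
Qed.

Lemma Olt_irr x : ~ Olt x x.
Proof. by move=> /negP; apply; exact: Ole_refl. Qed.

Lemma OltW x y : Olt x y -> Ole x y.
Proof. by move=> /negPf xy; have := Ole_total x y; rewrite xy orbF. Qed.

Lemma OleNgt x y : Ole x y = ~~ Olt y x.
Proof. by rewrite /Olt negbK. Qed.

Lemma Olt_trans y x z : Olt x y -> Olt y z -> Olt x z.
Proof.
move=> xy yz; apply/negP => zx; move: xy => /negP; apply.
exact: Ole_trans (OltW yz) zx.
Qed.

Lemma Olt_le_trans y x z : Olt x y -> Ole y z -> Olt x z.
Proof.
by move=> xy yz; apply/negP => zx; move: xy => /negP; apply; exact: Ole_trans zx.
Qed.

Lemma Ole_eqVlt x y : Ole x y -> x = y \/ Olt x y.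
Proof.
move=> xy; have [yx|yx] := boolP (Ole y x); last by right.
by left; exact: Ole_anti.
Qed.

Lemma OleP x y : Ole x y \/ Olt y x.
Proof. by rewrite /Olt; case: (Ole x y); [left|right]. Qed.

End order_facts.

(** Total two-sided relations stand in for isomorphisms, so that the comparison
    theorem can be proved without constructing maps. *)
Lemma Oeq_of_rel (a b : Ord) (R : a -> b -> Prop) :
  (forall x, exists y, R x y) -> (forall y, exists x, R x y) ->
  (forall x x' y y', R x y -> R x' y' -> Ole x x' = Ole y y') -> a =o b.
Proof.
move=> /choice[f fR] /choice[g gR] Rmono.
have inj (x x' : a) y : R x y -> R x' y -> x = x'.
  by move=> Rx Rx'; apply: Ole_anti; [rewrite (Rmono _ _ _ _ Rx Rx')|
    rewrite (Rmono _ _ _ _ Rx' Rx)]; exact: Ole_refl.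
have inj' (x : a) y y' : R x y -> R x y' -> y = y'.
  by move=> Rx Rx'; apply: Ole_anti; [rewrite -(Rmono _ _ _ _ Rx Rx')|
    rewrite -(Rmono _ _ _ _ Rx' Rx)]; exact: Ole_refl.
exists f; last by move=> x y; rewrite -(Rmono _ _ _ _ (fR x) (fR y)).
by exists g => x; [exact: inj (gR _) (fR _)|exact: inj' (fR _) (gR _)].
Qed.

Lemma Oeq_refl a : a =o a.
Proof. by exists id => //; exists id. Qed.

Lemma Oeq_sym a b : a =o b -> b =o a.
Proof.
move=> [f [g fK gK] fm]; exists g; first by exists f.
by move=> x y; rewrite -fm !gK.
Qed.

Lemma Oeq_trans b a c : a =o b -> b =o c -> a =o c.
Proof.
move=> [f fb fm] [g gb gm]; exists (g \o f); first exact: bij_comp.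
by move=> x y /=; rewrite gm fm.
Qed.

Lemma mono_Olt (a b : Ord) (f : a -> b) :
  {mono f : x y / Ole x y} -> {mono f : x y / Olt x y}.
Proof. by move=> fm x y; rewrite /Olt fm. Qed.

Lemma mono_Oinj (a b : Ord) (f : a -> b) :
  {mono f : x y / Ole x y} -> injective f.
Proof.
by move=> fm x y fxy; apply: Ole_anti; rewrite -fm fxy; exact: Ole_refl.
Qed.

(** The least point moved down would have a smaller image that is moved down as
    well. *)
Lemma mono_Oge (a : Ord) (f : a -> a) :
  {mono f : x y / Ole x y} -> forall x, Ole x (f x).
Proof.
move=> fm x; apply: contrapT => /negP; elim/(well_founded_ind (@Olt_wf a)): x.
by move=> x IH fx; apply: (IH (f x)) => //; rewrite fm.
Qed.

Lemma no_mono_below (a : Ord) (y : a) (f : a -> a) :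
  {mono f : u v / Ole u v} -> ~ (forall u, Olt (f u) y).
Proof.
by move=> fm fy; have := mono_Oge fm y; rewrite OleNgt fy.
Qed.

Definition Oval (a : Ord) (x : a) (u : Oseg x) : a := sval u.

Definition Osub (a : Ord) (x y : a) (yx : Olt y x) : Oseg x := exist _ y yx.

Lemma Oval_lt (a : Ord) (x : a) (u : Oseg x) : Olt (Oval u) x.
Proof. by case: u. Qed.

Lemma Oval_mono (a : Ord) (x : a) : {mono @Oval a x : u v / Ole u v}.
Proof. by []. Qed.

Definition Owiden (a : Ord) (x y : a) (xy : Ole x y) (u : Oseg x) : Oseg y :=
  Osub (Olt_le_trans (Oval_lt u) xy).

Section comparison.
Variables a b : Ord.
Let R (x : a) (y : b) := Oseg x =o Oseg y.

Lemma Oseg_Oeq_le x x' y y' : R x y -> R x' y' -> Ole x x' -> Ole y y'.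
Proof.
move=> /Oeq_sym[f _ fm] [g _ gm] xx'; case: (OleP y y') => // y'y; exfalso.
pose h (u : Oseg y) : Oseg y := Owiden (OltW y'y) (g (Owiden xx' (f u))).
apply: (@no_mono_below (Oseg y) (Osub y'y) h); last by move=> u; exact: Oval_lt.
by move=> u v; rewrite -[RHS]fm; exact: gm.
Qed.
End comparison.

Lemma Oseg_Oeq_mono (a b : Ord) (x x' : a) (y y' : b) :
  Oseg x =o Oseg y -> Oseg x' =o Oseg y' -> Ole x x' = Ole y y'.
Proof.
by move=> xy xy'; apply/idP/idP; apply: Oseg_Oeq_le => //; exact: Oeq_sym.
Qed.

(** Isomorphisms, inclusions of initial segments and left injections into sums
    are treated together. *)
Definition initial_embedding (a b : Ord) (f : a -> b) : Prop :=
  {mono f : x y / Ole x y} /\ forall x z, Olt z (f x) -> exists y, f y = z.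

Lemma iso_initial (a b : Ord) (f : a -> b) :
  bijective f -> {mono f : x y / Ole x y} -> initial_embedding f.
Proof. by move=> [g _ gK] fm; split=> // x z _; exists (g z). Qed.

Lemma Oval_initial (a : Ord) (x : a) : initial_embedding (@Oval a x).
Proof.
split=> // u z zu; have zx := Olt_trans zu (Oval_lt u).
by exists (Osub zx).
Qed.

Lemma Oseg_initial (a b : Ord) (f : a -> b) (x : a) :
  initial_embedding f -> Oseg x =o Oseg (f x).
Proof.
move=> [fm fi]; apply: (@Oeq_of_rel _ _ (fun v w => f (Oval v) = Oval w)).
- move=> v; have lt : Olt (f (Oval v)) (f x) by rewrite mono_Olt //; exact: Oval_lt.
  by exists (Osub lt).
- move=> w; have [y yw] := fi _ _ (Oval_lt w).
  have lt : Olt y x by rewrite -(mono_Olt fm) yw; exact: Oval_lt.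
  by exists (Osub lt).
- by move=> v v' w w' vw vw'; rewrite -!Oval_mono -vw -vw' fm.
Qed.

(** Related are the points with isomorphic initial segments; the least points
    left out on both sides would be related to each other. *)
Lemma Ordle_or_lt a b : a <=o b \/ b <o a.
Proof.
pose R (x : a) (y : b) := Oseg x =o Oseg y.
have Rdown c d (x x' : Ord_car c) (y : Ord_car d) : Oseg x =o Oseg y ->
    Ole x' x -> exists y' : d, Oseg x' =o Oseg y'.
  move=> [f fb fm] /Ole_eqVlt[->|x'x]; first by exists y, f.
  exists (Oval (f (Osub x'x))).
  apply: Oeq_trans (Oseg_initial _ (@Oval_initial _ _)).
  apply: Oeq_trans (Oseg_initial _ (iso_initial fb fm)).
  exact: Oeq_sym (Oseg_initial (Osub x'x) (@Oval_initial _ _)).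
have [Rl|/existsNP nRl] := pselect (forall x, exists y, R x y).
  left; have [Rr|/existsNP nRr] := pselect (forall y, exists x, R x y).
    by right; apply: (Oeq_of_rel Rl Rr) => *; exact: Oseg_Oeq_mono.
  left; have [y [nRy ymin]] := Ole_min nRr; exists y.
  apply: (@Oeq_of_rel _ _ (fun x w => R x (Oval w))).
  - move=> x; have [z Rxz] := Rl x; case: (OleP y z) => [yz|zy]; last by exists (Osub zy).
    exfalso; apply: nRy; have [x' x'y] := Rdown _ _ _ _ _ (Oeq_sym Rxz) yz.
    by exists x'; exact: Oeq_sym.
  - move=> w; apply: contrapT => /ymin; rewrite OleNgt; move=> /negP; apply.
    exact: Oval_lt.
  - by move=> x x' w w' Rx Rx'; rewrite -Oval_mono; exact: Oseg_Oeq_mono.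
have [x [nRx xmin]] := Ole_min nRl.
have Rx' (w : Oseg x) : exists y, R (Oval w) y.
  apply: contrapT => /xmin; rewrite OleNgt; move=> /negP; apply.
  exact: Oval_lt.
have Rlt z y : R z y -> Olt z x.
  move=> Rzy; case: (OleP x z) => // xz; exfalso; apply: nRx.
  exact: Rdown Rzy xz.
right; exists x; apply: Oeq_sym.
have [Rr|/existsNP nRr] := pselect (forall y, exists x, R x y).
  apply: (@Oeq_of_rel _ _ (fun w y => R (Oval w) y)) => //.
  - move=> y; have [z Rzy] := Rr y.
    by exists (Osub (Rlt _ _ Rzy)).
  - by move=> v v' y y' Rv Rv'; rewrite -Oval_mono; exact: Oseg_Oeq_mono.
have [y [nRy ymin]] := Ole_min nRr.
exfalso; apply: nRx; exists y.
apply: (@Oeq_of_rel _ _ (fun v w => R (Oval v) (Oval w))).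
- move=> v; have [z Rvz] := Rx' v.
  case: (OleP y z) => [yz|zy]; last by exists (Osub zy).
  exfalso; apply: nRy; have [x' x'y] := Rdown _ _ _ _ _ (Oeq_sym Rvz) yz.
  by exists x'; exact: Oeq_sym.
- move=> w; have [z Rzw] : exists z, R z (Oval w).
    apply: contrapT => /ymin; rewrite OleNgt; move=> /negP; apply.
    exact: Oval_lt.
  by exists (Osub (Rlt _ _ Rzw)).
- by move=> v v' w w' Rv Rv'; rewrite -!Oval_mono; exact: Oseg_Oeq_mono.
Qed.

Lemma not_Ordle_seg (a : Ord) (x : a) : ~ (a <=o Oseg x).
Proof.
move=> [[y [f _ fm]]|[f _ fm]].
- apply: (@no_mono_below a x (fun u => Oval (Oval (f u)))) => // u.
  exact: Oval_lt.
- apply: (@no_mono_below a x (fun u => Oval (f u))) => // u.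
  exact: Oval_lt.
Qed.

Lemma Ordle_refl a : a <=o a. Proof. by right; exact: Oeq_refl. Qed.

Lemma Ordle_mono (a b : Ord) : a <=o b <-> exists f : a -> b, {mono f : x y / Ole x y}.
Proof.
split=> [[[y [f _ fm]]|[f _ fm]]|[f fm]].
- by exists (fun u => Oval (f u)).
- by exists f.
- case: (Ordle_or_lt a b) => // -[x [g _ gm]]; exfalso.
  apply: (@no_mono_below a x (fun u => Oval (g (f u)))).
    by move=> u v; rewrite Oval_mono gm fm.
  by move=> u; exact: Oval_lt.
Qed.

Lemma Ordle_trans b a c : a <=o b -> b <=o c -> a <=o c.
Proof.
move=> /Ordle_mono[f fm] /Ordle_mono[g gm]; apply/Ordle_mono.
by exists (g \o f) => x y /=; rewrite gm fm.
Qed.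

Lemma Ordle_anti a b : a <=o b -> b <=o a -> a =o b.
Proof.
move=> [[y ay]|//] ba; exfalso; apply: (@not_Ordle_seg b y).
by apply: Ordle_trans ba _; right.
Qed.

Lemma Ordle_inj a b : a <=o b -> exists f : a -> b, injective f.
Proof. by move=> /Ordle_mono[f /mono_Oinj finj]; exists f. Qed.

Lemma Oeq_Ordle a b : a =o b -> a <=o b. Proof. by right. Qed.

(** * Least ordinals *)

Definition is_least (P : Ord -> Prop) (a : Ord) : Prop :=
  P a /\ forall b, P b -> a <=o b.

(** An isomorphism between [least_Ord P] and a nonempty ordinal already shows
    that some ordinal satisfies [P], because the default value is empty. *)
Lemma least_Ord_cases P : is_least P (least_Ord P) \/ least_Ord P = Onat 0.
Proof.
by rewrite /least_Ord; case: pselect => [e|_]; [left; case: cid|right].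
Qed.

(** Ordinals below a given witness are its initial segments, so the least one
    among them is found inside the witness. *)
Lemma least_OrdP P : (exists a, P a) -> is_least P (least_Ord P).
Proof.
move=> [a Pa]; rewrite /least_Ord; case: pselect => [e|]; first by case: cid.
case; pose Q (x : a) := exists b, P b /\ b =o Oseg x.
have [Q0|nQ] := pselect (exists x, Q x); last first.
  exists a; split=> // b Pb; case: (Ordle_or_lt a b) => // -[x bx].
  by exfalso; apply: nQ; exists x, b.
have [x [[b [Pb bx]] xmin]] := Ole_min Q0; exists b; split=> // c Pc.
case: (Ordle_or_lt b c) => // -[y cy]; exfalso.
have [f fb fm] := bx; have : Ole x (Oval (f y)).
  apply: xmin; exists c; split=> //; apply: Oeq_trans cy _.
  apply: Oeq_trans (Oseg_initial y (iso_initial fb fm)) _.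
  exact/Oseg_initial/Oval_initial.
by rewrite OleNgt Oval_lt.
Qed.

Lemma is_least_unique P a b : is_least P a -> is_least P b -> a =o b.
Proof. by move=> [Pa amin] [Pb bmin]; apply: Ordle_anti; auto. Qed.

Lemma well_ordered_set (T : Type) (A : set T) :
  exists (a : Ord) (f : a -> T), injective f /\ range f = A.
Proof.
have [R Rwo] := well_ordering_principle {classic {x | A x}}.
exists (MkOrd Rwo), (fun u => sval u); split.
  by move=> [x Ax] [y Ay] /= xy; exact: eq_exist.
by apply/seteqP; split=> [x [[y Ay] _ <-]//|x Ax]; exists (exist _ x Ax).
Qed.

(** * The first uncountable ordinal *)

Lemma no_injection_powerset (T : Type) (f : set T -> T) : ~ injective f.
Proof.
move=> finj; pose D := [set x | exists A, f A = x /\ ~ A x].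
have nD : ~ D (f D) by move=> [A [/finj ->]] nDD; apply: (nDD); exists D.
by apply: (nD); exists D.
Qed.

Lemma omega1P : is_least (fun k => ~ countable [set: k]) omega1.
Proof.
apply: least_OrdP; have [a [f [finj fr]]] := @well_ordered_set (set nat) setT.
exists a => ca; have : countable [set: set nat] by rewrite -fr; exact: countable_image.
move=> /countable_injP[g ginj]; apply: (@no_injection_powerset _ g) => A B.
by apply: ginj; rewrite inE.
Qed.

Lemma omega1_uncountable : ~ countable [set: omega1].
Proof. by case: omega1P. Qed.

Lemma omega1_min (a : Ord) : ~ countable [set: a] -> omega1 <=o a.
Proof. by case: omega1P => _; apply. Qed.

Lemma countable_lt_omega1 (a : Ord) : countable [set: a] -> a <o omega1.
Proof.
move=> ca; case: (Ordle_or_lt omega1 a) => // /Ordle_inj[f finj]; exfalso.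
apply: omega1_uncountable; apply: (@countable_preimage _ _ f _ setT) => //.
by move=> x y _ _ /finj.
Qed.

Lemma omega1_countable_lt (x : omega1) : countable [set y | Olt y x].
Proof.
have [cx|] := pselect (countable [set: Oseg x]); last first.
  by move=> /omega1_min /not_Ordle_seg.
suff -> : [set y | Olt y x] = range (@Oval omega1 x) by exact: countable_image.
apply/seteqP; split=> [y yx|_ [u _ <-]]; last exact: Oval_lt.
by exists (Osub yx).
Qed.

Lemma omega1_countable_le (x : omega1) : countable [set y | Ole y x].
Proof.
apply: (@countable_sub _ _ ([set y | Olt y x] `|` [set x])).
  by move=> y /Ole_eqVlt[->|]; [right|left].
by apply: countableU => //; exact: omega1_countable_lt.
Qed.

(** Otherwise [omega1] would be a countable union of countable initial
    segments. *)
Lemma omega1_bounded (A : set omega1) :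
  countable A -> exists x, forall y, A y -> Olt y x.
Proof.
move=> cA; apply: contrapT => nA; apply: omega1_uncountable.
have cU : countable (\bigcup_(y in A) [set z | Ole z y]).
  by apply: bigcup_countable => // y _; exact: omega1_countable_le.
apply: countable_sub cU => x _; apply: contrapT => nx; apply: nA.
exists x => y Ay; case: (OleP x y) => // xy.
by exfalso; apply: nx; exists y.
Qed.

Lemma uncountable_omega1 (T : Type) (A : set T) : ~ countable A ->
  exists f : omega1 -> T, injective f /\ forall x, A (f x).
Proof.
move=> nA; have [a [f [finj fA]]] := well_ordered_set A.
have /omega1_min/Ordle_inj[g ginj] : ~ countable [set: a].
  by move=> ca; apply: nA; rewrite -fA; exact: countable_image.
exists (f \o g); split; first exact: inj_comp.
by move=> x; rewrite -fA; exists (g x).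
Qed.

(** * Concentrated families of functions *)

(** For an injective family, this says that its range is a Lusin set, as the
    compact sets of functions are the closed pointwise bounded ones. Families
    are more convenient than sets, since they need not be injective. *)
Definition concentrated_family (I : Type) (f : I -> nat -> nat) : Prop :=
  forall h : nat -> nat, countable [set i | forall k, (f i k <= h k)%N].

Definition has_concentrated_family : Prop :=
  exists f : omega1 -> nat -> nat, concentrated_family f.

(** Only the sizes of the index sets matter: a copy of [omega1] in [I] and a
    numbering of [D] transport the family. *)
Lemma has_concentrated_familyI (I T : Type) (D : set T) (f : I -> T -> nat) :
  countable D -> ~ countable [set: I] ->
  (forall h : T -> nat, countable [set i | forall d, D d -> (f i d <= h d)%N]) ->
  has_concentrated_family.
Proof.
move=> /countable_injP[g ginj] nI fh.
pose F i k := if pselect (exists2 d, D d & g d = k) is left e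
              then f i (s2val (cid2 e)) else 0%N.
have FE i d : D d -> F i (g d) = f i d.
  move=> Dd; rewrite /F; case: pselect => [e|]; last by case; exists d.
  case: cid2 => d' /= Dd' gd; congr (f i _).
  by apply: ginj; rewrite ?inE.
have [e [einj _]] := uncountable_omega1 nI.
exists (fun x => F (e x)) => h.
apply: (@countable_preimage _ _ e _ _ _ _ (fh (h \o g))).
  by move=> x y _ _ /einj.
by move=> x /= Fh d Dd; rewrite -FE.
Qed.

(** The fibres are countable, as the fibre of [f i] is bounded by [f i]. *)
Lemma uncountable_range_concentrated (I T : Type) (f : I -> nat -> nat)
    (phi : (nat -> nat) -> T) : ~ countable [set: I] ->
  concentrated_family f -> injective phi -> ~ countable (range (phi \o f)).
Proof.
move=> nI fc phi_inj cr; apply: nI; apply: countable_fibers cr => y.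
have [[i _ fi]|ny] := pselect (range (phi \o f) y); last first.
  apply: (@countable_sub _ _ set0) => // i [_ /= fi]; exfalso.
  by apply: ny; exists i.
apply: countable_sub (fc (f i)) => j [_ /=].
by rewrite -fi => /phi_inj -> k.
Qed.

(** * The bounding number *)

Lemma le_starP f g : le_star f g <-> exists N, forall n, (N <= n)%N -> (f n <= g n)%N.
Proof.
split=> [[N _ NP]|[N NP]]; first by exists N => n; exact: NP.
by exists N => // n; exact: NP.
Qed.

(** At [n], take the maximum of the functions numbered up to [n]. *)
Lemma le_star_countable_bound (B : set (nat -> nat)) :
  countable B -> exists g, forall f, B f -> le_star f g.
Proof.
move=> /countable_injP[c cinj].
pose e k := if pselect (exists2 f, B f & c f = k) is left e
            then s2val (cid2 e) else fun=> 0%N.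
have eE f : B f -> e (c f) = f.
  move=> Bf; rewrite /e; case: pselect => [x|]; last by case; exists f.
  by case: cid2 => f' /= Bf' cf; apply: cinj; rewrite ?inE.
exists (fun n => \max_(k < n.+1) e k n) => f Bf; apply/le_starP.
exists (c f) => n cn; rewrite -{1}(eE f Bf).
exact: (@leq_bigmax _ (fun k : 'I_n.+1 => e k n) (Ordinal (cn : (c f < n.+1)%N))).
Qed.

(** Eventual domination by [g] amounts to domination by some [g + m]. *)
Lemma le_star_concentrated (I : Type) (f : I -> nat -> nat) g :
  concentrated_family f -> countable [set i | le_star (f i) g].
Proof.
move=> fc; apply: (@countable_sub _ _
  (\bigcup_(m in [set: nat]) [set i | forall k, (f i k <= g k + m)%N])).
  move=> i /le_starP[N NP]; exists (\max_(k < N) f i k) => // k.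
  case: (ltnP k N) => [kN|/NP kN]; last exact: leq_trans (leq_addr _ _).
  apply: leq_trans (leq_addl _ _).
  exact: (@leq_bigmax _ (fun k : 'I_N => f i k) (Ordinal kN)).
by apply: bigcup_countable => // m _; exact: fc.
Qed.

(** Let [g x] eventually dominate the members up to [x] of an unbounded family
    [e]. A pointwise bound [h] for [g x] fails to dominate some [e y]
    eventually, which forces [x] to precede [y]. *)
Lemma concentrated_of_bounding :
  bounding_number =o omega1 -> has_concentrated_family.
Proof.
move=> bw; case: (least_Ord_cases
  (fun k => exists2 B, unbounded_star B & B #= [set: k])); last first.
  rewrite -/bounding_number => b0; exfalso; apply: omega1_uncountable.
  rewrite b0 in bw; have [f [g fK gK] _] := bw.
  by apply: (@countable_preimage _ 'I_0 g setT setT) => // x y _ _ /(can_inj gK).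
rewrite -/bounding_number => -[[B nB Bb] _].
have [e eB] : exists e : omega1 -> nat -> nat, B `<=` range e.
  move: Bb => /card_eqPle[/pcard_surjP[g gB] _].
  have [f [f' _ f'K] _] := Oeq_sym bw.
  exists (g \o f) => h /gB[x _ <-]; exists (f' x) => //=.
  by rewrite f'K.
have /choice[g gP] x : exists g, forall y, Ole y x -> le_star (e y) g.
  have [g gb] := le_star_countable_bound
    (countable_image e (omega1_countable_le x)).
  by exists g => y yx; apply: gb; exists y.
exists g => h.
have [f Bf nf] : exists2 f, B f & ~ le_star f h.
  by apply: contra_notP nB => nf; exists h => f Bf; apply: contrapT => nfh;
    apply: nf; exists f.
have [y _ yf] := eB _ Bf; apply: countable_sub (omega1_countable_lt y) => x /= xh.
case: (OleP y x) => // /gP/le_starP[N NP]; exfalso; apply: nf.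
apply/le_starP; exists N => n Nn; rewrite -yf.
exact: leq_trans (NP _ Nn) (xh n).
Qed.

Lemma bounding_of_concentrated :
  has_concentrated_family -> bounding_number =o omega1.
Proof.
move=> [f fc]; have fstar g : countable [set x | le_star (f x) g].
  exact: le_star_concentrated.
have nB : unbounded_star (range f).
  move=> [g gP]; apply: omega1_uncountable; apply: countable_sub (fstar g) => x _.
  by apply: gP; exists x.
apply: (@is_least_unique (fun k => exists2 B, unbounded_star B & B #= [set: k])).
  apply: least_OrdP; have [a [e [einj er]]] := well_ordered_set (range f).
  exists a, (range f) => //; rewrite -er; apply: inj_card_eq.
  by move=> x y _ _ /einj.
have nc B : unbounded_star B -> ~ countable B.
  by move=> nBB /le_star_countable_bound.
split; last first.
  move=> b [B nBB Bb]; apply: omega1_min.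
  by rewrite -(eq_countable Bb); exact: nc.
exists (range f) => //; apply/card_eqPle; split; first exact: card_image_le.
have [e [einj ef]] := uncountable_omega1 (nc _ nB).
apply: (@card_le_trans _ _ _ (range e)).
  have /card_eqPle[_ ->//] : range e #= [set: omega1].
  by apply: inj_card_eq => x y _ _ /einj.
by apply: subset_card_le => _ [x _ <-].
Qed.

(** * Lusin sets *)

(** Each function has a neighbourhood on which the [k]-th value is constant;
    compactness makes the resulting local bounds uniform. *)
Lemma compact_dominated (K : set {ptws nat -> nat}) : compact K ->
  exists h : nat -> nat, forall f, K f -> forall k, (f k <= h k)%N.
Proof.
move=> /compact_near_coveringP cK.
suff /choice[h hP] k : exists n, forall f : {ptws nat -> nat}, K f -> (f k <= n)%N.
  by exists h => f Kf k; exact: hP.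
have [|N _ NP] := cK nat \oo (fun n (f : {ptws nat -> nat}) => (f k <= n)%N) _.
  move=> f Kf; exists ((fun g : {ptws nat -> nat} => g k) @^-1` [set f k],
                       [set n | (f k <= n)%N]) => /=.
    split; last by exists (f k).
    exact: (@proj_continuous nat (fun=> nat) k f).
  by move=> [g n] /= [->].
by exists N => f Kf; exact: (NP N (leqnn N)).
Qed.

Lemma dominated_compact (h : nat -> nat) :
  compact [set f : {ptws nat -> nat} | forall k, (f k <= h k)%N].
Proof.
apply: (@tychonoff nat (fun=> nat) (fun k => [set n | (n <= h k)%N])) => k.
by apply: finite_compact; exact: (@finite_II (h k).+1).
Qed.

Lemma concentrated_of_Lusin (L : set {ptws nat -> nat}) :
  ~ countable L -> K_Lusin L -> has_concentrated_family.
Proof.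
move=> nL LL; have [e [einj eL]] := uncountable_omega1 nL.
exists e => h.
apply: (@countable_preimage _ _ e _ _ _ _ (LL _ (@dominated_compact h))).
  by move=> x y _ _; exact: einj.
by move=> x xh; split; [exact: xh|exact: eL].
Qed.

Lemma Lusin_of_concentrated : has_concentrated_family ->
  exists L : set {ptws nat -> nat}, ~ countable L /\ K_Lusin L.
Proof.
move=> [f fc]; exists (range f); split.
  exact: (uncountable_range_concentrated omega1_uncountable fc (@inj_id _)).
move=> K /compact_dominated[h hP].
apply: (@countable_sub _ _ (f @` [set x | forall k, (f x k <= h k)%N])).
  by move=> g [Kg [x _ xg]]; exists x => //= k; rewrite xg; exact: hP.
exact: countable_image.
Qed.

(** * Concentration around a countable set *)

Lemma first_countable_seq (X : topologicalType) (x : X) : first_countable X ->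
  exists V : nat -> set X, (forall n, nbhs x (V n)) /\
    forall W, nbhs x W -> exists n, V n `<=` W.
Proof.
move=> /(_ x)[B [/countable_injP[c cinj] Bx Bbase]].
pose V n := if pselect (exists2 U, B U & c U = n) is left e
            then s2val (cid2 e) else setT.
have VE U : B U -> V (c U) = U.
  move=> BU; rewrite /V; case: pselect => [e|]; last by case; exists U.
  by case: cid2 => U' /= BU' cU; apply: cinj; rewrite ?inE.
exists V; split; last by move=> W /Bbase[U BU UW]; exists (c U); rewrite VE.
move=> n; rewrite /V; case: pselect => [e|_]; last exact: filterT.
by case: cid2 => U BU cU; exact: Bx.
Qed.

(** Let [f i d] be the index of a basic neighbourhood of [d] that misses [x i].
    If [f i] is bounded by [h], then [x i] lies outside the open set obtained by
    intersecting, for each [d], the basic neighbourhoods up to index [h d]. *)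
Lemma concentrated_around (X : topologicalType) (D : set X) (I : Type)
    (x : I -> X) : hausdorff_space X -> first_countable X -> countable D ->
  ~ countable [set: I] -> (forall i, ~ D (x i)) ->
  (forall U, open U -> D `<=` U -> countable [set i | ~ U (x i)]) ->
  has_concentrated_family.
Proof.
move=> hX fX cD nI xD xU.
have /choice[V VP] := fun d => @first_countable_seq X d fX.
have /choice[f fP] i : exists f : X -> nat, forall d, D d -> ~ V d (f d) (x i).
  suff /choice[f fP] d : exists n, D d -> ~ V d n (x i) by exists f.
  have [Dd|nD] := pselect (D d); last by exists 0%N.
  have /(VP d).2[n Vn] : nbhs d [set~ x i].
    apply: open_nbhs_nbhs; split; last by move=> /= dx; apply: (xD i); rewrite -dx.
    apply: closed_openC; exact/accessible_closed_set1/hausdorff_accessible.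
  by exists n => _ /Vn; apply.
apply: (@has_concentrated_familyI _ _ D f cD nI) => h.
pose U := \bigcup_(d in D) (\bigcap_(n in [set n | (n <= h d)%N]) V d n)°.
have oU : open U by apply: bigcup_open => d _; exact: open_interior.
apply: countable_sub (xU U oU _) => [i /= fh|d Dd].
  move=> [d Dd /interior_subset xV]; apply: (fP i d Dd); apply: xV; exact: fh.
exists d => //; rewrite /interior.
have -> : [set n | (n <= h d)%N] = `I_(h d).+1 by [].
rewrite bigcap_mkord; elim/big_ind: _ => [|A B|n _].
- exact: filterT.
- exact: filterI.
- exact: (VP d).1.
Qed.

(** * Concentrated sets of reals *)

Lemma first_countable_real (R : realType) : first_countable R.
Proof.
move=> x; exists (range (fun n => ball x (n.+1%:R^-1 : R)%R)); split.
- exact: countable_image.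
- by move=> _ [n _ <-]; apply: nbhsx_ballx; rewrite invr_gt0 ltr0n.
- move=> V /nbhs_ballP[e /= e0 eV].
  have [n ne] : exists n, (n.+1%:R^-1 < e :> R)%R.
    have [N _ NP] := near_infty_natSinv_lt (PosNum e0).
    by exists N; exact: (NP N (leqnn N)).
  exists (ball x (n.+1%:R^-1 : R)%R); first by exists n.
  by apply: subset_trans eV; apply: le_ball; exact: ltW.
Qed.

Lemma concentrated_of_Q_concentrated (R : realType) (A : set R) :
  ~ countable A -> Q_concentrated A -> has_concentrated_family.
Proof.
move=> nA AQ; pose Q : set R := range (@ratr R).
have cQ : countable Q by apply: countable_image; exact: countableP.
apply: (@concentrated_around R Q {x | A x /\ ~ Q x} (fun u => sval u)) => //.
- exact: first_countable_real.
- move=> cI; apply: nA; apply: (@countable_sub _ _ (Q `|`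
      range (fun u : {x | A x /\ ~ Q x} => sval u))).
    move=> x Ax; have [Qx|nQx] := pselect (Q x); first by left.
    by right; exists (exist _ x (conj Ax nQx)).
  by apply: countableU => //; exact: countable_image.
- by move=> [x [Ax nQx]].
- move=> U oU QU; apply: (@countable_preimage _ _ (fun u => sval u) _ _ _ _ (AQ U oU QU)).
    by move=> [x ?] [y ?] _ _ /= xy; exact: eq_exist.
  by move=> [x [Ax nQx]].
Qed.

(** König's lemma: the [k]-th level of the tree is the finite list [T k], on
    which [N] has a maximum. *)
Lemma finite_branching_dominated (N : seq nat -> nat) :
  exists h : nat -> nat, forall f : nat -> nat,
    (forall k, (f k <= N (mkseq f k))%N) -> forall k, (f k <= h k)%N.
Proof.
pose T := fix T k := if k is k.+1
  then [seq rcons s j | s <- T k, j <- iota 0 (N s).+1] else [:: [::]].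
exists (fun k => \max_(s <- T k) N s) => f fN.
have fT k : mkseq f k \in T k.
  elim: k => [|k IH]; first by rewrite inE.
  rewrite -[T k.+1]/[seq rcons s j | s <- T k, j <- iota 0 (N s).+1].
  rewrite mkseqS; apply/allpairsPdep; exists (mkseq f k), (f k).
  by split=> //; rewrite mem_iota add0n ltnS fN.
by move=> k; apply: leq_trans (fN k) _; exact: leq_bigmax_seq.
Qed.

Section sparse_expansion.
Variable R : realType.
Local Open Scope ring_scope.
Implicit Types f g : nat -> nat.

Definition digit_weight f n : R := 3^-1 ^+ (\sum_(i < n) (f i).+1).

Definition partial_expansion f n : R := \sum_(k < n) digit_weight f k.+1.

(** The real number in [0, 1] whose ternary expansion consists of runs of 0s of
    lengths [f 0], [f 1], [f 2] and so on, each followed by a single 1. *)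
Definition sparse_expansion f : R := sup (range (partial_expansion f)).

Lemma digit_weight_gt0 f n : 0 < digit_weight f n.
Proof. by rewrite exprn_gt0// invr_gt0 ltr0n. Qed.

Lemma digit_weightS f n :
  digit_weight f n.+1 = digit_weight f n * 3^-1 ^+ (f n).+1.
Proof. by rewrite /digit_weight big_ord_recr exprD. Qed.

Lemma digit_weightS_le f n : digit_weight f n.+1 <= digit_weight f n / 3.
Proof.
rewrite digit_weightS ler_pM2l ?digit_weight_gt0// exprS ler_piMr//.
by rewrite exprn_ile1// invf_le1// ler1n.
Qed.

Lemma partial_expansionS f n :
  partial_expansion f n.+1 = partial_expansion f n + digit_weight f n.+1.
Proof. by rewrite /partial_expansion big_ord_recr. Qed.

Lemma partial_expansion_eq f g n : (forall i, (i < n)%N -> f i = g i) ->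
  digit_weight f n = digit_weight g n /\
  partial_expansion f n = partial_expansion g n.
Proof.
elim: n => [|n IH] fg; first by rewrite /digit_weight /partial_expansion !big_ord0.
have [wE pE] : digit_weight f n = digit_weight g n /\
    partial_expansion f n = partial_expansion g n.
  by apply: IH => i ni; apply: fg; rewrite ltnW.
by rewrite !partial_expansionS !digit_weightS wE pE fg.
Qed.

(** The partial sums increase, whereas they decrease once half of the last
    weight is added, since weights decrease at least by the factor 3. *)
Lemma partial_expansion_bound f n m :
  partial_expansion f m <= partial_expansion f n + digit_weight f n / 2.
Proof.
have ub k : partial_expansion f (n + k) + digit_weight f (n + k) / 2 <=
            partial_expansion f n + digit_weight f n / 2.
  elim: k => [|k IH]; first by rewrite addn0.
  apply: le_trans IH; rewrite addnS partial_expansionS.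
  by have := digit_weightS_le f (n + k); lra.
have mono k : partial_expansion f m <= partial_expansion f (m + k).
  elim: k => [|k IH]; first by rewrite addn0.
  apply: le_trans IH _; rewrite addnS partial_expansionS.
  by have := digit_weight_gt0 f (m + k).+1; lra.
apply: le_trans (mono n) _; apply: le_trans (ub m); rewrite addnC.
by have := digit_weight_gt0 f (n + m); lra.
Qed.

Lemma sparse_expansion_bounds f n :
  partial_expansion f n <= sparse_expansion f
    <= partial_expansion f n + digit_weight f n / 2.
Proof.
apply/andP; split.
  apply: ub_le_sup; last by exists n.
  exists (partial_expansion f 0 + digit_weight f 0 / 2) => _ [m _ <-].
  exact: partial_expansion_bound.
apply: ge_sup; first by exists (partial_expansion f 0), 0%N.
by move=> _ [m _ <-]; exact: partial_expansion_bound.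
Qed.

(** At the first difference, the number with the shorter run of 0s is larger:
    its next 1 outweighs the whole remaining expansion of the other one. *)
Lemma sparse_expansion_inj : injective sparse_expansion.
Proof.
suff lt f g n : (forall i, (i < n)%N -> f i = g i) -> (f n < g n)%N ->
    sparse_expansion g < sparse_expansion f.
  move=> f g fg; apply: contrapT => nfg.
  have [n fgn] : exists n, f n != g n.
    apply: contrapT => nn; apply: nfg; apply/funext => n; apply/eqP.
    by apply: contrapT => /negP fgn; apply: nn; exists n.
  have [{fgn}n fgn nmin] := ex_minnP (ex_intro (fun n => f n != g n) n fgn).
  have agree i : (i < n)%N -> f i = g i.
    by rewrite ltnNge => ni; apply/eqP; apply: contraNT ni; exact: nmin.
  move: (fgn); rewrite neq_ltn => /orP[fn|fn].
    by have := lt _ _ _ agree fn; rewrite fg ltxx.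
  have agree' i (ni : (i < n)%N) := esym (agree i ni).
  by have := lt _ _ _ agree' fn; rewrite fg ltxx.
move=> /partial_expansion_eq[wE pE] fgn.
have /andP[lo _] := sparse_expansion_bounds f n.+1.
have /andP[_ hi] := sparse_expansion_bounds g n.+1.
have w0 := digit_weight_gt0 f n.+1.
have wle : digit_weight g n.+1 <= digit_weight f n.+1 / 3.
  rewrite !digit_weightS wE -mulrA ler_pM2l ?digit_weight_gt0//.
  rewrite -exprSr; apply: ler_wiXn2l => //.
  by rewrite invf_le1// ler1n.
by move: lo hi; rewrite !partial_expansionS pE; lra.
Qed.

Lemma partial_expansion_rat f n : range (@ratr R) (partial_expansion f n).
Proof.
elim: n => [|n [q _ qE]].
  by exists 0 => //; rewrite rmorph0 /partial_expansion big_ord0.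
exists (q + 3^-1 ^+ (\sum_(i < n.+1) (f i).+1)) => //.
rewrite partial_expansionS -qE (rmorphD (@ratr R)) /digit_weight.
by rewrite (rmorphXn (@ratr R)) fmorphV rmorph_nat.
Qed.

Lemma sparse_expansion_near f n :
  `|partial_expansion f n - sparse_expansion f| <= 3^-1 ^+ f n.
Proof.
have /andP[lo _] := sparse_expansion_bounds f n.
have /andP[_ hi] := sparse_expansion_bounds f n.+1.
have w1 : digit_weight f n <= 1.
  by rewrite exprn_ile1// ?invr_ge0// invf_le1// ler1n.
have w : digit_weight f n.+1 <= 3^-1 ^+ f n / 3.
  rewrite digit_weightS exprSr mulrA ler_pM2r// ler_piMl//.
have p0 : 0 <= 3^-1 ^+ f n :> R by rewrite exprn_ge0// invr_ge0.
rewrite distrC ger0_norm ?subr_ge0//.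
by move: hi; rewrite partial_expansionS; lra.
Qed.

(** A number whose expansion has a long run of 0s after a given finite pattern
    is close to the rational number with that pattern, hence in [U]; so the
    numbers outside [U] come from the branches of a finitely branching tree. *)
Lemma sparse_expansion_dominated (U : set R) : open U -> range (@ratr R) `<=` U ->
  exists h : nat -> nat, forall f,
    ~ U (sparse_expansion f) -> forall k, (f k <= h k)%N.
Proof.
move=> oU QU.
suff /choice[N NP] (s : seq nat) : exists N, forall f, mkseq f (size s) = s ->
    ~ U (sparse_expansion f) -> (f (size s) <= N)%N.
  have [h hP] := finite_branching_dominated N; exists h => f nU.
  apply: hP => k; have := NP (mkseq f k) f; rewrite size_mkseq.
  exact.
have /QU Up := partial_expansion_rat (nth 0%N s) (size s).
have /nbhs_ballP[e /= e0 eU] : nbhs (partial_expansion (nth 0%N s) (size s)) U.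
  exact: open_nbhs_nbhs.
have [N NP] : exists N, forall n, (N <= n)%N -> 3^-1 ^+ n < e.
  have : (fun n => 3^-1 ^+ n : R) @ \oo --> (0 : R).
    apply: cvg_expr; rewrite ger0_norm ?invr_ge0// invf_lt1//.
    by rewrite ltr1n.
  move=> /cvgrPdist_lt/(_ _ e0)[N _ NP]; exists N => n /NP /=.
  by rewrite sub0r normrN ger0_norm// exprn_ge0// invr_ge0.
exists N => f fs nU; rewrite leqNgt; apply/negP => /ltnW/NP small.
apply: nU; apply: eU; rewrite /ball /=.
apply: le_lt_trans small; apply: le_trans (sparse_expansion_near f (size s)).
have [_ <-] : digit_weight f (size s) = digit_weight (nth 0%N s) (size s) /\
    partial_expansion f (size s) = partial_expansion (nth 0%N s) (size s).
  by apply: partial_expansion_eq => i si; rewrite -[in RHS]fs nth_mkseq.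
exact: lexx.
Qed.

End sparse_expansion.

Lemma Q_concentrated_of_concentrated (R : realType) : has_concentrated_family ->
  exists A : set R, ~ countable A /\ Q_concentrated A.
Proof.
move=> [f fc]; exists (range (@sparse_expansion R \o f)); split.
  exact: (uncountable_range_concentrated omega1_uncountable fc
    (@sparse_expansion_inj R)).
move=> U oU QU; have [h hP] := sparse_expansion_dominated oU QU.
apply: (@countable_sub _ _ ((@sparse_expansion R \o f) @`
    [set x | forall k, (f x k <= h k)%N])); last exact: countable_image.
by move=> _ [[x _ <-] nU]; exists x => //; exact: hP.
Qed.

(** * Derived sets *)

Section derived_sets.
Variable X : topologicalType.
Implicit Types A B : set X.

Lemma derived_setE A : derived_set A = A `&` limit_point A.
Proof.
apply/seteqP; split=> [x [Ax nx]|x [Ax lx]]; split=> //.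
  have : closure A x by exact: subset_closure.
  by rewrite closure_isolated_limit_point => -[].
move=> ix; have : (isolated A `&` limit_point A) x by [].
by have /disj_setPS/(_ x) := disjoint_isolated_limit_point A.
Qed.

Lemma derived_set_sub A : derived_set A `<=` A.
Proof. by rewrite derived_setE => x []. Qed.

Lemma derived_setS A B : A `<=` B -> derived_set A `<=` derived_set B.
Proof.
move=> AB; rewrite !derived_setE => x [Ax lx]; split; first exact: AB.
by move=> U /lx[y [yx /AB By Uy]]; exists y.
Qed.

Lemma derived_set_closed A : closed A -> closed (derived_set A).
Proof.
move=> cA x xA; have Ax : A x.
  by apply: cA => U /xA[y [/derived_set_sub Ay Uy]]; exists y.
have [//|nx] := pselect (derived_set A x); rewrite derived_setE; split=> // U.
move=> /xA[y [yA Uy]]; exists y; split=> //; last exact: derived_set_sub.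
by apply/eqP => yx; apply: nx; rewrite -yx.
Qed.

Lemma iter_derived_set_sub A j k : (j <= k)%N ->
  iter k (@derived_set X) A `<=` iter j (@derived_set X) A.
Proof.
move=> /subnK <-; elim: (k - j)%N => // i IH.
by rewrite addSn /=; exact: subset_trans (@derived_set_sub _) IH.
Qed.

Lemma lindelof_closed_cover (J : Type) (O : J -> set X) (F : set X) :
  lindelof X -> closed F -> (forall j, open (O j)) -> F `<=` \bigcup_j O j ->
  exists2 J0 : set J, countable J0 & F `<=` \bigcup_(j in J0) O j.
Proof.
move=> lX cF oO FO; have [||D [DC cD DT]] := lX (range O `|` [set ~` F]).
- by move=> U [[j _ <-]//|->]; exact: closed_openC.
- apply/seteqP; split=> // x _; have [Fx|nFx] := pselect (F x).
    by have [j _ Ox] := FO _ Fx; exists (O j) => //; left; exists j.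
  by exists (~` F) => //; right.
pose c U : set J := if pselect (exists j, O j = U) is left e
                    then [set projT1 (cid e)] else set0.
exists (\bigcup_(U in D) c U).
  apply: bigcup_countable => // U _; rewrite /c; case: pselect => // e.
move=> x Fx; have [U DU Ux] : (\bigcup_(U in D) U) x by rewrite DT.
have [[j _ jU]|UF] := DC _ DU; last by rewrite UF in Ux.
have [k kc Ok] : exists2 k, c U k & O k = U.
  rewrite /c; case: pselect => [e|]; last by case; exists j.
  by exists (projT1 (cid e)) => //; case: cid.
by exists k; [exists U|rewrite Ok].
Qed.

(** * The Cantor-Bendixson sequence *)

Lemma CB_atE (a : Ord) (x : a) :
  CB_at X x = \bigcap_(y in [set y : a | Olt y x]) derived_set (CB_at X y).
Proof.
rewrite {1}/CB_at Fix_eq; last first.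
  move=> y f g fg; congr bigcap; apply/funext => z; congr derived_set.
  exact: fg.
apply/seteqP; split=> [p pP y yx|p pP [y yx] _]; last exact: pP.
exact: (pP (exist _ y yx)).
Qed.

Lemma CB_at_lt (a : Ord) (x y : a) :
  Olt y x -> CB_at X x `<=` derived_set (CB_at X y).
Proof. by move=> yx p; rewrite CB_atE => /(_ y yx). Qed.

Lemma CB_at_le (a : Ord) (x y : a) : Ole y x -> CB_at X x `<=` CB_at X y.
Proof.
move=> /Ole_eqVlt[->//|/CB_at_lt yx]; apply: subset_trans yx _.
exact: derived_set_sub.
Qed.

Lemma CB_at_closed (a : Ord) (x : a) : closed (CB_at X x).
Proof.
elim/(well_founded_ind (@Olt_wf a)): x => x IH.
rewrite CB_atE; apply: closed_bigI => y yx.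
by apply: derived_set_closed; exact: IH.
Qed.

Lemma CB_closed (a : Ord) : closed (CB X a).
Proof.
apply: closed_bigI => y _; apply: derived_set_closed; exact: CB_at_closed.
Qed.

Lemma CB_at_initial (a b : Ord) (f : a -> b) (x : a) :
  initial_embedding f -> CB_at X (f x) = CB_at X x.
Proof.
move=> [fm fi]; elim/(well_founded_ind (@Olt_wf a)): x => x IH.
rewrite !CB_atE; apply/seteqP; split=> p pP y yx.
  by rewrite -(IH y yx); apply: pP; rewrite /= (mono_Olt fm).
have [z zy] := fi _ _ yx; rewrite -zy IH; first apply: pP.
  by rewrite /= -(mono_Olt fm) zy.
by rewrite -(mono_Olt fm) zy.
Qed.

Lemma CB_Oseg (a : Ord) (x : a) : CB X (Oseg x) = CB_at X x.
Proof.
rewrite CB_atE; apply/seteqP; split=> [p pP y yx|p pP y _].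
  rewrite -[y]/(Oval (Osub yx)) (CB_at_initial _ (@Oval_initial _ _)).
  exact: pP.
rewrite -(CB_at_initial _ (@Oval_initial _ _)); exact/pP/Oval_lt.
Qed.

Lemma CB_Oeq (a b : Ord) : a =o b -> CB X a = CB X b.
Proof.
move=> [f fb fm]; have fi := iso_initial fb fm; have [g fK gK] := fb.
apply/seteqP; split=> p pP y _; last by rewrite -(CB_at_initial _ fi); exact: pP.
by rewrite -(gK y) (CB_at_initial _ fi); exact: pP.
Qed.

Lemma inl_initial (a b : Ord) : initial_embedding (inl : a -> Oadd a b).
Proof. by split=> // x [z|z] // _; exists z. Qed.

Section successors.
Variables (a : Ord) (n : nat).
Let b := Oadd a (Onat n).
Let below (k : nat) : set b :=
  [set y | if y is inr j then (nat_of_ord j < k)%N else true].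

Let CB_below k : (k <= n)%N ->
  (forall j : 'I_n, (j < k)%N ->
    CB_at X (inr j : b) = iter j (@derived_set X) (CB X a)) ->
  \bigcap_(y in below k) derived_set (CB_at X y) =
    iter k (@derived_set X) (CB X a).
Proof.
move=> kn IH; apply/seteqP; split=> [p pP|p pk [y|j] /= jk].
- case: k kn IH pP => [|k] kn IH pP.
    move=> y _; rewrite -(CB_at_initial y (inl_initial a (Onat n))).
    exact: (pP (inl y)).
  have := pP (inr (Ordinal kn)) (leqnn k.+1).
  by rewrite IH.
- have /(_ y I) := iter_derived_set_sub (leq0n k) pk.
  by rewrite -(CB_at_initial y (inl_initial a (Onat n))).
- rewrite IH//; exact: (iter_derived_set_sub jk pk).
Qed.

Let CB_at_inr (k : 'I_n) :
  CB_at X (inr k : b) = iter k (@derived_set X) (CB X a).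
Proof.
elim/(well_founded_ind (@Olt_wf (Onat n))): k => k IH.
have {}IH (j : 'I_n) : (j < k)%N ->
    CB_at X (inr j : b) = iter j (@derived_set X) (CB X a).
  by move=> jk; apply: IH; rewrite /Olt /= -ltnNge.
rewrite -(CB_below (ltnW (ltn_ord k)) IH) CB_atE.
congr bigcap; apply/funext => -[y|j]; rewrite /below /Olt /=.
  by rewrite propeqE.
by rewrite -ltnNge.
Qed.

Lemma CB_Oadd_nat :
  CB X (Oadd a (Onat n)) = iter n (@derived_set X) (CB X a).
Proof.
by rewrite -CB_below//; congr bigcap; apply/funext => -[y|j]; rewrite /below propeqE//=.
Qed.
End successors.

(** * The scattered height *)

(** If no set in the sequence were empty, picking isolated points would map any
    ordinal injectively to [X]; but the power set of [X] can be well-ordered. *)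
Lemma scattered_heightP :
  scattered X -> is_least (fun a => CB X a = set0) (scattered_height X).
Proof.
move=> sX; apply: least_OrdP.
have [a [f [finj fr]]] := @well_ordered_set (set X) setT.
suff [x x0] : exists x : a, CB_at X x = set0.
  by exists (Oseg x); rewrite CB_Oseg.
apply: contrapT => /forallNP CBn0.
have /choice[p pP] (x : a) : exists p, (CB_at X x `\` derived_set (CB_at X x)) p.
  have [|p ip] := sX (CB_at X x); first exact/set0P/eqP.
  exists p; split; first exact: isolatedS.
  by move=> [].
have /choice[g gP] (B : set X) : exists x, f x = B.
  by have : range f B by [rewrite fr]; move=> [x _ <-]; exists x.
apply: (@no_injection_powerset _ (p \o g)); apply: inj_comp; last first.
  by move=> A B gAB; rewrite -(gP A) -(gP B) gAB.
have lt x y : Olt x y -> p x <> p y.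
  move=> /CB_at_lt xy pxy; have [_] := pP x; apply.
  by rewrite pxy; apply: xy; case: (pP y).
move=> x y pxy; case: (OleP x y) => [/Ole_eqVlt[//|/lt//]|/lt].
by rewrite pxy.
Qed.

Lemma CB_at_neq0 (a : Ord) (x : a) : scattered X ->
  scattered_height X =o a -> CB_at X x !=set0.
Proof.
move=> /scattered_heightP[_ hmin] ha; apply/set0P/eqP => x0.
apply: (@not_Ordle_seg a x); apply: Ordle_trans (hmin (Oseg x) _).
  exact/Oeq_Ordle/Oeq_sym.
by rewrite CB_Oseg.
Qed.

Lemma scattered_height_eq (a : Ord) :
  (forall x : a, CB_at X x !=set0) -> CB X a = set0 -> scattered_height X =o a.
Proof.
move=> CBn0 CB0; apply: (@is_least_unique (fun a => CB X a = set0)).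
  by apply: least_OrdP; exists a.
split=> // b b0; case: (Ordle_or_lt a b) => // -[x bx]; exfalso.
by have /set0P/eqP := CBn0 x; apply; rewrite -CB_Oseg -(CB_Oeq bx).
Qed.

End derived_sets.

(** * Spaces of finite height and of height with cofinality [omega1] *)

(** Outside an open set containing the derived set, [E] is closed and discrete,
    hence countable by the Lindelof property. *)
Lemma concentrated_of_countable_derived (X : topologicalType) (E : set X) :
  FLS X -> closed E -> countable (derived_set E) -> ~ countable E ->
  has_concentrated_family.
Proof.
move=> [hX fX lX sX] cE cD nE.
pose S := {x | (E `\` derived_set E) x}.
apply: (@concentrated_around X (derived_set E) S (fun u => sval u)) => //.
- move=> cS; apply: nE; apply: (@countable_sub _ _ (derived_set E `|`
      range (fun u : S => sval u))).
    move=> x Ex; have [Dx|nDx] := pselect (derived_set E x); first by left.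
    by right; exists (exist _ x (conj Ex nDx)).
  by apply: countableU => //; exact: countable_image.
- by move=> [x [Ex nDx]].
move=> U oU DU.
have /choice[W WP] (x : X) : exists V : set X, [/\ open V, V `&` E `<=` [set x] &
    (E `\` derived_set E) x -> V x].
  have [[Ex nDx]|nx] := pselect ((E `\` derived_set E) x); last first.
    by exists set0; split=> [|y []|//]; first exact: open0.
  have [_ [V xV VE]] : isolated E x by apply: contrapT => nix; apply: nDx.
  exists V°; split=> [|y [/interior_subset Vy Ey]|_]; first exact: open_interior.
    by rewrite -VE.
  exact: xV.
have [| | | |J0 cJ0 J0P] := @lindelof_closed_cover X X W (E `&` ~` U).
- exact: lX.
- by apply: closedI => //; exact: open_closedC.
- by move=> x; case: (WP x).
- move=> x [Ex nUx]; exists x => //; case: (WP x) => _ _; apply; split=> //.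
  by move=> /DU.
apply: (@countable_preimage _ _ (fun u : S => sval u) _ _ _ _ cJ0).
  by move=> [x ?] [y ?] _ _ /= xy; exact: eq_exist.
move=> [x [Ex nDx]] /= nUx; have [//|y Jy Wyx] := J0P x.
by case: (WP y) => _ /(_ x (conj Wyx Ex)) -> _.
Qed.

(** Among the iterated derived sets of [E], the last uncountable one is followed
    by a countable one. *)
Lemma concentrated_of_iter_derived (X : topologicalType) n (E : set X) :
  FLS X -> closed E -> iter n (@derived_set X) E = set0 -> ~ countable E ->
  has_concentrated_family.
Proof.
move=> fX; elim: n E => [|n IH] E cE; first by move=> /= ->.
rewrite iterSr => E0 nE.
have [cD|nD] := pselect (countable (derived_set E)).
  exact: concentrated_of_countable_derived cE cD nE.
by apply: IH E0 nD; exact: derived_set_closed.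
Qed.

Lemma concentrated_of_finite_height (X : topologicalType) n :
  ~ countable [set: X] -> FLS X -> scattered_height X =o Onat n ->
  has_concentrated_family.
Proof.
move=> nX fX hn; have CB0 : CB X (Onat 0) = setT.
  by apply/seteqP; split=> // x _ [].
apply: (@concentrated_of_iter_derived X n setT) => //.
rewrite -CB0 -CB_Oadd_nat.
have <- : CB X (scattered_height X) = set0 by case: fX => _ _ _ /scattered_heightP[].
apply/esym/CB_Oeq; apply: Oeq_trans hn _.
apply: (@Oeq_of_rel (Onat n) (Oadd (Onat 0) (Onat n)) (fun x y => inr x = y)).
- by move=> x; exists (inr x).
- by move=> [[]//|x]; exists x.
- by move=> x x' _ _ <- <-.
Qed.

Lemma Onat0_not_omega1 : ~ (Onat 0 =o omega1).
Proof.
move=> [f [g fK gK] _]; apply: omega1_uncountable.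
by apply: (@countable_preimage _ 'I_0 g setT setT) => // x y _ _ /(can_inj gK).
Qed.

Lemma cf_omega1 (a : Ord) : cf a =o omega1 ->
  (exists f : omega1 -> a, forall x, exists i, Ole x (f i)) /\
  (forall A : set a, countable A -> exists x, forall y, A y -> Olt y x).
Proof.
move=> cfw; case: (least_Ord_cases
  (fun k => exists f : k -> a, forall x, exists i, Ole x (f i))); last first.
  by rewrite -/(cf a) => cf0; exfalso; apply: Onat0_not_omega1; rewrite -cf0.
rewrite -/(cf a) => -[[f fP] cfmin]; split.
  have [g [g' gK _] _] := cfw.
  exists (f \o g') => x; have [i xi] := fP x.
  by exists (g i); rewrite /= gK.
move=> A cA; apply: contrapT => nA.
have [b [e [einj eA]]] := well_ordered_set A.
have cb : countable [set: b].
  apply: (@countable_preimage _ _ e _ _ _ _ cA) => [x y _ _ /einj//|x _].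
  by rewrite -eA; exists x.
have [x bx] := countable_lt_omega1 cb.
apply: (@not_Ordle_seg omega1 x); apply: (@Ordle_trans (cf a)).
  exact/Oeq_Ordle/Oeq_sym.
apply: (@Ordle_trans b); last exact: Oeq_Ordle.
apply: cfmin; exists e => y; apply: contrapT => ny; apply: nA.
exists y => z; rewrite -eA => -[i _ <-]; case: (OleP y (e i)) => // yi.
by exfalso; apply: ny; exists i.
Qed.

(** Write the height as [m + n] with [m] of cofinality [omega1]. If [CB X m] is
    uncountable, finitely many further derivations lead to the empty set and
    the argument for finite heights applies. Otherwise points chosen in [omega1]
    cofinal levels below [m] concentrate around [CB X m]. *)
Lemma concentrated_of_cf_height (X : topologicalType) : FLS X ->
  cf (lim_Ord (scattered_height X)) =o omega1 -> has_concentrated_family.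
Proof.
move=> fX cfw; have [hX fcX lX sX] := fX; have [[f fcof] fbd] := cf_omega1 cfw.
case: (least_Ord_cases (fun m => limit_Ord m /\
    exists n, scattered_height X =o Oadd m (Onat n))); last first.
  rewrite -/(lim_Ord _) => l0; rewrite l0 in f fcof.
  exfalso; apply: omega1_uncountable.
  by apply: (@countable_preimage _ 'I_0 f setT setT) => // x y; case: (f x).
rewrite -/(lim_Ord _); set m := lim_Ord _ in f fcof fbd *.
move=> [[_ [n hn]] _]; pose E := CB X m.
have Ecl : closed E by exact: CB_closed.
have [cE|nE] := pselect (countable E); last first.
  apply: (@concentrated_of_iter_derived X n E) => //.
  by rewrite -CB_Oadd_nat -(CB_Oeq X hn); case: (scattered_heightP sX).
have CBn0 (y : m) : CB_at X y !=set0.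
  rewrite -(CB_at_initial X y (inl_initial m (Onat n))).
  exact: CB_at_neq0.
(* Dominating all earlier values of the cofinal map makes the levels [al x]
   increase enough for each bound to be passed after countably many steps. *)
have /choice[al alP] (x : omega1) : exists y : m, forall z, Ole z x -> Olt (f z) y.
  have [y yP] := fbd _ (countable_image f (omega1_countable_le x)).
  by exists y => z zx; apply: yP; exists z.
have /choice[p pP] (x : omega1) :
    exists p, (CB_at X (al x) `\` derived_set (CB_at X (al x))) p.
  have [p ip] := sX _ (CBn0 (al x)).
  by exists p; split; [exact: isolatedS|move=> []].
apply: (@concentrated_around X E omega1 p) => //.
- exact: omega1_uncountable.
- by move=> x Epx; have [_] := pP x; apply; exact: Epx.
move=> U oU EU.
have [| | | |J cJ JP] := @lindelof_closed_cover X m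
    (fun y => ~` derived_set (CB_at X y)) (~` U).
- exact: lX.
- exact: open_closedC.
- move=> y; apply: closed_openC; apply: derived_set_closed.
  exact: CB_at_closed.
- move=> x nUx; apply: contrapT => nx; apply/nUx/EU => y _.
  by apply: contrapT => ny; apply: nx; exists y.
(* The derived sets of the levels in [J] have an intersection contained in [U],
   and the level [b] is contained in all of them. *)
have [b bP] := fbd _ cJ; have [i bi] := fcof b.
apply: countable_sub (omega1_countable_lt i) => x /= nUx.
case: (OleP i x) => // ix; exfalso.
have bx : Ole b (al x) by apply: Ole_trans bi (OltW (alP _ _ ix)).
have [j Jj] := JP _ nUx; apply; have [px _] := pP x.
apply: (CB_at_lt (bP _ Jj)); exact: (CB_at_le bx).
Qed.

(** * Attaching hubs to a sum of spaces *)

Section open_embeddings.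
Variables (Y X : topologicalType) (f : Y -> X).
Hypothesis f_inj : injective f.
Hypothesis f_cont : continuous f.
Hypothesis f_open : forall y U, nbhs y U -> nbhs (f y) (f @` U).

Lemma derived_set_open_embedding (A : set X) :
  f @^-1` derived_set A = derived_set (f @^-1` A).
Proof.
rewrite !derived_setE; apply/seteqP; split=> [y /= [Ay ly]|y /= [Ay ly]]; split=> //.
- move=> U /f_open/ly[w [wy Aw [z Uz zw]]]; exists z; split=> //.
    by apply: contraNneq wy => <-; rewrite zw.
  by rewrite /= zw.
- move=> V /f_cont/ly[z [zy Az Vz]]; exists (f z); split=> //.
  by apply: contra_neq zy; exact: f_inj.
Qed.

Lemma CB_at_open_embedding (a : Ord) (x : a) :
  f @^-1` CB_at X x = CB_at Y x.
Proof.
elim/(well_founded_ind (@Olt_wf a)): x => x IH.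
rewrite !CB_atE preimage_bigcap; apply: eq_bigcapr => y yx.
by rewrite derived_set_open_embedding IH.
Qed.

End open_embeddings.

(** The sum of the spaces [Y i] with additional points, the hubs; the basic
    neighbourhoods of the hub [d] are indexed by [n] and consist of [d] and the
    summands [Y i] with [n <= r d i]. Encoding the neighbourhoods by the rank
    [r] makes them decreasing, and makes each summand leave them eventually. *)
Definition hub_space (D : Type) (I : choiceType) (Y : I -> topologicalType)
  (r : D -> I -> nat) : Type := (D + {i & Y i})%type.

Section hub_topology.
Context {D : Type} {I : choiceType} {Y : I -> topologicalType}
  {r : D -> I -> nat}.
Let H := hub_space Y r.

HB.instance Definition _ := gen_eqMixin H.
HB.instance Definition _ := gen_choiceMixin H.

Definition hub_open : set_system H := [set O |
  open ((inr : {i & Y i} -> H) @^-1` O) /\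
  forall d, O (inl d) -> exists n, forall q, (n <= r d (projT1 q))%N -> O (inr q)].

Let hub_openT : hub_open setT.
Proof. by split=> [|d _]; [exact: openT|exists 0%N]. Qed.

Let hub_openI : setI_closed hub_open.
Proof.
move=> A B [oA hA] [oB hB]; split; first exact: openI.
move=> d [/hA[n nA] /hB[m mB]]; exists (maxn n m) => q.
by rewrite geq_max => /andP[nq mq]; split; [exact: nA|exact: mB].
Qed.

Let hub_open_bigU (J : Type) (f : J -> set H) :
  (forall j, hub_open (f j)) -> hub_open (\bigcup_j f j).
Proof.
move=> of_; split.
  by rewrite preimage_bigcup; apply: bigcup_open => j _; case: (of_ j).
move=> d [j _ fd]; have [_ /(_ d fd)[n nf]] := of_ j.
by exists n => q nq; exists j => //; exact: nf.
Qed.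

HB.instance Definition _ :=
  isOpenTopological.Build H hub_openT hub_openI hub_open_bigU.

End hub_topology.

Definition hub_separated (D I : Type) (r : D -> I -> nat) : Prop :=
  forall d e, d <> e -> exists n, forall i, (r d i < n)%N \/ (r e i < n)%N.

Definition hub_concentrated (D I : Type) (r : D -> I -> nat) : Prop :=
  forall h : D -> nat, countable [set i | forall d, (r d i < h d)%N].

Section hub_spaces.
Variables (D : Type) (I : choiceType) (Y : I -> topologicalType)
  (r : D -> I -> nat).
Local Notation H := (hub_space Y r).

Lemma hub_openE (U : set H) : open U = hub_open U.
Proof. by []. Qed.

Definition hub_ball (d : D) (n : nat) : set H :=
  [set p | match p with inl e => e = d | inr q => (n <= r d (projT1 q))%N end].

Lemma hub_ball_open d n : open (hub_ball d n).
Proof.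
rewrite hub_openE; split; last by move=> _ ->; exists n.
apply/sigT_openP => i.
have [ni|ni] := boolP (n <= r d i)%N.
  by rewrite (_ : _ @^-1` _ = setT); [exact: openT|apply/seteqP; split].
rewrite (_ : _ @^-1` _ = set0); first exact: open0.
by apply/seteqP; split=> // y /= niy; move: ni; rewrite niy.
Qed.

Lemma nbhs_hub d (A : set H) :
  nbhs (inl d : H) A <-> exists n, hub_ball d n `<=` A.
Proof.
rewrite nbhsE; split=> [[U [[_ oU] Ud] UA]|[n nA]]; last first.
  by exists (hub_ball d n) => //; split; [exact: hub_ball_open|].
have [n nU] := oU d Ud; exists n => -[_ ->|q /nU]; exact: UA.
Qed.

Lemma nbhs_inr q (A : set H) :
  nbhs (inr q : H) A <-> nbhs q (inr @^-1` A).
Proof.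
rewrite !nbhsE; split=> [[U [[oU _] Uq] UA]|[U [oU Uq] UA]].
  by exists (inr @^-1` U) => // z; exact: UA.
exists (inr @` U) => [|_ [z Uz <-]]; last exact: UA.
split; last by exists q.
split=> [|d [z _ //]]; rewrite (_ : _ @^-1` _ = U)//.
by apply/seteqP; split=> [z [w Uw [<-]]//|z Uz]; exists z.
Qed.

Definition spoke (i : I) (y : Y i) : H := inr (existT Y i y).

Lemma spoke_inj i : injective (@spoke i).
Proof. by move=> y z [yz]; exact: existT_inj2 yz. Qed.

Lemma nbhs_spoke i y (A : set H) :
  nbhs (spoke y) A <-> nbhs y (@spoke i @^-1` A).
Proof. exact: nbhs_inr. Qed.

Lemma spoke_continuous i : continuous (@spoke i).
Proof. by move=> y A /nbhs_spoke. Qed.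

Lemma spoke_open i y U : nbhs y U -> nbhs (spoke y) (@spoke i @` U).
Proof. by move=> yU; apply/nbhs_spoke; apply: filterS yU => z Uz; exists z. Qed.

Lemma CB_at_spoke (a : Ord) (x : a) i : @spoke i @^-1` CB_at H x = CB_at (Y i) x.
Proof.
apply: CB_at_open_embedding.
- exact: spoke_inj.
- exact: spoke_continuous.
- exact: spoke_open.
Qed.

Lemma derived_set_spoke (A : set H) i :
  @spoke i @^-1` derived_set A = derived_set (@spoke i @^-1` A).
Proof.
apply: derived_set_open_embedding.
- exact: spoke_inj.
- exact: spoke_continuous.
- exact: spoke_open.
Qed.

Lemma derived_set_hubs (A : set H) : A `<=` range inl -> derived_set A = set0.
Proof.
move=> Ah; apply/seteqP; split=> // p [Ap np]; apply: np.
split; first exact/mem_set.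
have [d _ dp] := Ah _ Ap; exists (hub_ball d 0).
  by rewrite -dp; apply/nbhs_hub; exists 0%N.
rewrite -dp; apply/seteqP; split=> [q [dq /Ah[e _ eq]]|_ ->].
  by move: dq; rewrite -eq /= => ->.
by split=> //; rewrite dp.
Qed.

Lemma hub_hausdorff : hub_separated r -> (forall i, hausdorff_space (Y i)) ->
  hausdorff_space H.
Proof.
move=> rsep hY.
have mixed d q : ~ cluster (nbhs (inl d : H)) (inr q : H).
  move=> /(_ (hub_ball d (r d (projT1 q)).+1) (inr @` (existT Y (projT1 q) @` setT))).
  case.
  - by apply/nbhs_hub; exists (r d (projT1 q)).+1.
  - apply/nbhs_inr; case: q => i y /=.
    apply: (filterS _ (@existT_nbhs _ Y i y setT filterT)).
    by move=> _ [z _ <-]; exists (existT Y i z) => //; exists z.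
  - by move=> p [+ [w [z _ zw] wp]]; rewrite -wp -zw /= ltnn.
have sym p q : cluster (nbhs (p : H)) q -> cluster (nbhs q) p.
  by move=> pq A B qA pB; rewrite setIC; exact: pq.
move=> [d|p] [e|q] cl.
- apply: contrapT => de.
  have [n nP] : exists n, forall i, (r d i < n)%N \/ (r e i < n)%N.
    by apply: rsep => dE; apply: de; rewrite dE.
  have [||[c|q] []] := cl (hub_ball d n) (hub_ball e n).
  + by apply/nbhs_hub; exists n.
  + by apply/nbhs_hub; exists n.
  + by move=> /= -> dE; apply: de; rewrite dE.
  + by move=> /=; case: (nP (projT1 q)); rewrite ltnNge => /negPf ->.
- by case: (@mixed d q).
- by case: (@mixed e p); exact: sym.
congr inr; apply: (sigT_hausdorff hY) => A B pA qB.
have [||s [[u Au us] [v Bv vs]]] := cl (inr @` A) (inr @` B).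
- by apply/nbhs_inr; apply: filterS pA => z Az; exists z.
- by apply/nbhs_inr; apply: filterS qB => z Bz; exists z.
have [uv] : inr u = inr v :> D + {i & Y i} by rewrite us vs.
by exists u; split=> //; rewrite uv.
Qed.

Lemma hub_first_countable : (forall i, first_countable (Y i)) ->
  first_countable H.
Proof.
move=> fY [d|[i y]].
  exists (range (hub_ball d)); split; first exact: countable_image.
  - by move=> _ [n _ <-]; apply/nbhs_hub; exists n.
  - by move=> V /nbhs_hub[n nV]; exists (hub_ball d n).
have [B [cB By Bb]] := fY i y; exists ((fun U => @spoke i @` U) @` B); split.
- exact: countable_image.
- by move=> _ [U BU <-]; apply: spoke_open; exact: By.
- move=> V /nbhs_spoke/Bb[U BU UV]; exists (@spoke i @` U); first by exists U.
  by move=> _ [z Uz <-]; exact: UV.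
Qed.

(** The hubs are covered by countably many open sets, which then contain all but
    countably many summands. *)
Lemma hub_lindelof : countable [set: D] -> hub_concentrated r ->
  (forall i, lindelof (Y i)) -> lindelof H.
Proof.
move=> cD rconc lY C Copen CT.
have Cmem p : exists2 U, C U & U p.
  by have : (\bigcup_(U in C) U) p by rewrite CT.
have /choice[V VP] (d : D) : exists U, C U /\ U (inl d : H).
  by have [U CU Ud] := Cmem (inl d); exists U.
have /choice[h hP] (d : D) : exists n, hub_ball d n `<=` V d.
  by apply/nbhs_hub; apply: open_nbhs_nbhs; have [/Copen] := VP d.
have /choice[K KP] (i : I) : exists K : set {U | C U}, countable K /\
    forall y : Y i, exists2 U, K U & sval U (spoke y).
  have [| | |K cK KP] := @lindelof_closed_cover (Y i) {U | C U}
      (fun U => @spoke i @^-1` sval U) setT (lY i).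
  - exact: closedT.
  - move=> [U CU] /=; apply: open_comp; last exact: Copen.
    by move=> y _; exact: spoke_continuous.
  - by move=> y _; have [U CU Uy] := Cmem (spoke y); exists (exist _ U CU).
  - by exists K; split=> // y; have [U KU Uy] := KP y Logic.I; exists U.
exists (range V `|` \bigcup_(i in [set i | forall d, (r d i < h d)%N])
    (fun U => sval U) @` K i); split.
- move=> U [[d _ <-]|[i _ [[W CW] _ <-]//]]; exact: (VP d).1.
- apply: countableU; first exact: countable_image.
  by apply: bigcup_countable => // i _; apply: countable_image; case: (KP i).
- apply/seteqP; split=> // -[d|[i y]] _.
    by exists (V d); [left; exists d|exact: (VP d).2].
  have [iJ|/existsNP[d /negP]] := pselect (forall d, (r d i < h d)%N).
    have [_ /(_ y)[U KU Uy]] := KP i.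
    by exists (sval U) => //; right; exists i => //; exists U.
  rewrite -leqNgt => hr; exists (V d); first by left; exists d.
  exact: hP.
Qed.

Lemma hub_scattered : (forall i, scattered (Y i)) -> scattered H.
Proof.
move=> sY A [p Ap].
have [[i [y Ay]]|nA] := pselect (exists i y, A (@spoke i y)).
  have [z [/set_mem Az [V zV VA]]] : isolated (@spoke i @^-1` A) !=set0.
    by apply: sY; exists y.
  exists (spoke z); split; first exact/mem_set.
  exists (@spoke i @` V); first exact: spoke_open.
  apply/seteqP; split=> [_ [[w Vw <-] Aw]|_ ->].
    have : (V `&` @spoke i @^-1` A) w by [].
    by rewrite VA => ->.
  by split=> //; exists z => //; exact: nbhs_singleton.
have Ah : A `<=` range inl.
  move=> [d|[i y]] Ad; first by exists d.
  by exfalso; apply: nA; exists i, y.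
exists p; apply: contrapT => np.
by have := derived_set_hubs Ah; rewrite -subset0 => /(_ p); apply.
Qed.

Lemma hub_FLS : countable [set: D] -> hub_separated r -> hub_concentrated r ->
  (forall i, FLS (Y i)) -> FLS H.
Proof.
move=> cD rsep rconc fY; split.
- by apply: hub_hausdorff => // i; case: (fY i).
- by apply: hub_first_countable => i; case: (fY i).
- by apply: hub_lindelof => // i; case: (fY i).
- by apply: hub_scattered => i; case: (fY i).
Qed.

End hub_spaces.

(** * A tree of hubs over a concentrated family *)

(** The branch [f x] is close to the node [s] if it passes through [s] and
    leaves it through a large value. The pairs [(s, k)] are indices close to
    the node [s] only. *)
Definition branch_rank (f : omega1 -> nat -> nat) (s : seq nat)
    (i : {classic omega1} + (seq nat * nat)) : nat :=
  match i with
  | inl x => if mkseq (f x) (size s) == s then f x (size s) else 0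
  | inr (t, k) => if t == s then k else 0
  end.

Lemma nth_le_sumn (s : seq nat) i : (nth 0 s i <= sumn s)%N.
Proof.
elim: s i => [|x s IH] [|i] //=; first exact: leq_addr.
exact: leq_trans (IH i) (leq_addl _ _).
Qed.

(** A branch passing through both of two distinct nodes leaves the shorter one
    through an entry of the longer one. *)
Lemma branch_rank_separated f : hub_separated (branch_rank f).
Proof.
move=> s t st; exists (sumn s + sumn t).+1 => -[x|[u k]] /=; last first.
  by case: (eqVneq u s) => [->|_]; [right|left=> //]; case: eqP.
suff no (u v : seq nat) : (size u < size v)%N -> mkseq (f x) (size v) = v ->
    (f x (size u) <= sumn v)%N.
  case: (eqVneq _ s) => [sE|_]; last by left.
  case: (eqVneq _ t) => [tE|_]; last by right.
  case: (ltngtP (size s) (size t)) => lt.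
  - by left; rewrite ltnS (leq_trans (no _ _ lt tE))// leq_addl.
  - by right; rewrite ltnS (leq_trans (no _ _ lt sE))// leq_addr.
  - by exfalso; apply: st; rewrite -sE -tE lt.
by move=> uv vE; rewrite -(nth_mkseq 0%N (f x) uv) vE nth_le_sumn.
Qed.

Lemma branch_rank_concentrated f :
  concentrated_family f -> hub_concentrated (branch_rank f).
Proof.
move=> fc h; apply: countable_sum; last exact: countableP.
have [g gP] := finite_branching_dominated h.
apply: countable_sub (fc g) => x /= xh; apply: gP => k.
by have := xh (mkseq (f x) k); rewrite size_mkseq eqxx => /ltnW.
Qed.

Lemma branch_rank_private f s n : exists i, (n <= branch_rank f s i)%N /\
  forall t, t <> s -> branch_rank f t i = 0%N.
Proof.
exists (inr (s, n)); rewrite /= eqxx; split=> // t ts.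
by case: eqP => // st; exfalso; exact: ts.
Qed.

(** * An uncountable space of height 2 *)

(** Realised as a single hub without summands, the one-point space inherits its
    properties from the general construction. *)
Definition point_space : topologicalType :=
  hub_space (fun _ : void => (nat : topologicalType)) (fun (_ : unit) _ => 0%N).

Lemma point_FLS : FLS point_space.
Proof.
apply: hub_FLS => //.
- by move=> [] [].
- by move=> h; apply: (@countable_sub _ _ set0) => // -[].
Qed.

Lemma point_spaceE (p : point_space) : p = inl tt.
Proof. by move: p => [[]|[[]]]. Qed.

Lemma CB_ge2 (X : topologicalType) (l : Ord) : Onat 2 <=o l ->
  derived_set (derived_set [set: X]) = set0 -> CB X l = set0.
Proof.
move=> /Ordle_mono[f fm] X2; rewrite -subset0 -X2 => p /(_ (f ord_max) Logic.I).
apply: derived_setS; apply: subset_trans (derived_setS (@subsetT _ _)).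
by apply: (CB_at_lt (y := f ord0)); rewrite (mono_Olt fm).
Qed.

Section height_two.
Variable f : omega1 -> nat -> nat.
Hypothesis fc : concentrated_family f.
Let Z := hub_space (fun _ => point_space) (branch_rank f).
Let pt i : Z := spoke (branch_rank f) (i := i) (inl tt : point_space).

Lemma height_two_FLS : FLS Z.
Proof.
apply: hub_FLS.
- exact: countableP.
- exact: branch_rank_separated.
- exact: branch_rank_concentrated.
- by move=> i; exact: point_FLS.
Qed.

Lemma height_two_uncountable : ~ countable [set: Z].
Proof.
move=> cZ; apply: omega1_uncountable.
apply: (@countable_preimage _ _ (fun x : omega1 => pt (inl x)) _ _ _ _ cZ) => //.
by move=> x y _ _ [].
Qed.

Let inrE q : (inr q : Z) = pt (projT1 q).
Proof. by case: q => i y; rewrite /pt -(point_spaceE y). Qed.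

Let nbhs_pt i : nbhs (pt i) [set pt i].
Proof.
apply/nbhs_spoke; rewrite (_ : _ @^-1` _ = setT); first exact: filterT.
by apply/seteqP; split=> // y _ /=; rewrite (point_spaceE y).
Qed.

Let ball s n : set Z := hub_ball s n.

Let ball_private s n : exists i, ball s n (pt i) /\
  forall t m, t <> s -> ~ ball t m.+1 (pt i).
Proof.
have [i [ni i0]] := branch_rank_private f s n.
by exists i; split=> // t m /i0 ti; rewrite /hub_ball /= ti.
Qed.

Let derived_hub s : derived_set [set: Z] (inl s).
Proof.
rewrite derived_setE; split=> // U /nbhs_hub[n nU].
by have [i [ni _]] := ball_private s n; exists (pt i); split=> //; [exact/eqP|exact: nU].
Qed.

Lemma height_two_derived2 : derived_set (derived_set [set: Z]) = set0.
Proof.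
apply: derived_set_hubs => -[d _|q]; first by exists d.
rewrite inrE => -[_]; case; split; first exact/mem_set.
by exists [set pt (projT1 q)]; [exact: nbhs_pt|rewrite setIT].
Qed.

Lemma height_two_height : scattered_height Z =o Onat 2.
Proof.
apply: scattered_height_eq; last first.
  by apply: CB_ge2; [exact: Ordle_refl|exact: height_two_derived2].
move=> x; exists (inl [::]); rewrite CB_atE => y yx; rewrite (_ : CB_at Z y = setT)//.
apply/seteqP; split=> // p _; rewrite CB_atE => z zy; exfalso.
move: yx zy; rewrite /Olt /= -!ltnNge => yx zy.
by have := leq_ltn_trans (leq_ltn_trans (leq0n z) zy) yx;
  have := ltn_ord x; case: (nat_of_ord x) (nat_of_ord y) yx zy => [|[|]] // _ [|[]].
Qed.

(** The balls around hubs are regular open: every neighbourhood of another hub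
    contains private isolated points of that hub, which are not in the closure
    of the ball. *)
Lemma height_two_semiregular : semiregular Z.
Proof.
have hZ : hausdorff_space Z by case: height_two_FLS.
split=> [U <-|[d|q] A]; first exact: open_interior.
- move=> /nbhs_hub[n nA]; exists (ball d n.+1); last first.
    by move=> [e ed|q nq]; apply: nA => //; exact: ltnW.
  split=> //; apply/seteqP; split; last first.
    by rewrite -open_subsetE; [exact: subset_closure|exact: hub_ball_open].
  have cl i : closure (ball d n.+1) (pt i) ->
      ball d n.+1 (pt i).
    by move=> /(_ _ (nbhs_pt i))[p [pB pE]]; rewrite -pE.
  move=> [e|q]; last by move=> /interior_subset; rewrite inrE; exact: cl.
  rewrite /interior => /nbhs_hub[m mB]; have [//|de] := pselect (e = d).
  have [i [im ni]] := ball_private e m; exfalso.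
  by apply: (ni d n (nesym de)); apply: cl; exact: mB.
- rewrite inrE => qA; exists [set pt (projT1 q)].
    split=> //; rewrite /regopen -(closure_id _).1; last first.
      exact/accessible_closed_set1/hausdorff_accessible.
    apply/seteqP; split; first exact: interior_subset.
    by move=> _ ->; exact: nbhs_pt.
  by move=> _ ->; exact: nbhs_singleton qA.
Qed.

End height_two.

(** * Spaces of every height below [omega2] *)

Lemma card_le_inj (T U : Type) :
  [set: T] #<= [set: U] <-> exists f : T -> U, injective f.
Proof.
split=> [/card_leP[f]|[f finj]].
  exists (fun x => val (f (to_setT x))) => x y /val_inj.
  by move=> /(@inj _ _ _ f) => /(_ (in_setT _) (in_setT _)) /(congr1 val).
have /card_eqPle[_ Tf] : range f #= [set: T].
  by apply: inj_card_eq => x y _ _ /finj.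
exact: card_le_trans Tf (card_leT _).
Qed.

Lemma omega2P : is_least (fun k => ~ ([set: k] #<= [set: omega1])) omega2.
Proof.
apply: least_OrdP; have [a [f [finj fr]]] := @well_ordered_set (set omega1) setT.
exists a => /card_le_inj[g ginj].
have /choice[f' f'K] (A : set omega1) : exists x, f x = A.
  by have : range f A by [rewrite fr]; move=> [x _ <-]; exists x.
apply: (@no_injection_powerset _ (g \o f')); apply: inj_comp => // A B AB.
by rewrite -(f'K A) -(f'K B) AB.
Qed.

Lemma lt_omega2_inj (l : Ord) : l <o omega2 <-> exists j : l -> omega1, injective j.
Proof.
rewrite -card_le_inj; split=> [[x lx]|lw].
  apply: contrapT => /(proj2 omega2P) w2l; apply: (@not_Ordle_seg omega2 x).
  by apply: Ordle_trans w2l _; exact: Oeq_Ordle.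
case: (Ordle_or_lt omega2 l) => // /Ordle_inj[f finj]; exfalso.
apply: (proj1 omega2P); move: lw => /card_le_inj[j jinj]; apply/card_le_inj.
by exists (j \o f); exact: inj_comp.
Qed.

Section hub_heights.
Variables (a : Ord) (x : a) (D : Type) (I : choiceType)
  (Y : I -> topologicalType) (r : D -> I -> nat) (b : I -> a).
Local Notation H := (hub_space Y r).

Lemma hub_derived_CB : (forall i, Olt (b i) x) ->
  (forall i, derived_set (CB_at (Y i) (b i)) = set0) ->
  derived_set (CB_at H x) = set0.
Proof.
move=> bx b0; apply: derived_set_hubs => -[d _|[i y] px]; first by exists d.
have : derived_set (CB_at (Y i) (b i)) y.
  by apply: (CB_at_lt (bx i)); rewrite -(CB_at_spoke Y r x).
by rewrite b0.
Qed.

Lemma hub_in_CB (d : D) : (forall i, CB_at (Y i) (b i) !=set0) ->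
  (forall n z, Olt z x -> exists2 i, (n <= r d i)%N & Ole z (b i)) ->
  CB_at H x (inl d).
Proof.
move=> bn0 bcof; suff : forall z, Ole z x -> CB_at H z (inl d).
  by apply; exact: Ole_refl.
move=> z; elim/(well_founded_ind (@Olt_wf a)): z => z IH zx.
rewrite CB_atE => y yz; have yx := Olt_le_trans yz zx.
rewrite derived_setE; split; first exact: IH yz (OltW yx).
move=> U /nbhs_hub[n nU]; have [i ni yi] := bcof n y yx.
have [w /(CB_at_le yi) wy] := bn0 i.
exists (spoke r w); split; [exact/eqP| |exact: nU].
by move: wy; rewrite -(CB_at_spoke Y r y).
Qed.

End hub_heights.

(** The height of [X] is the successor of the order type of the points below
    [x]. *)
Definition has_exact_height (a : Ord) (x : a) (X : topologicalType) : Prop :=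
  [/\ FLS X, CB_at X x !=set0 & derived_set (CB_at X x) = set0].

Lemma countable_sig (T : Type) (A : set T) :
  countable A -> countable [set: {classic {x | A x}}].
Proof.
move=> cA; apply: (@countable_preimage _ _ (fun u : {x | A x} => sval u) _ _ _ _ cA).
  by move=> [x ?] [y ?] _ _ /= xy; exact: eq_exist.
by move=> [].
Qed.

(** By recursion on [x], the summands [Y y] are spaces of the heights given by
    points [y] below [x], and the set left at level [x] must consist of hubs
    and contain at least one of them. *)
Lemma exact_height_exists (l : Ord) (x : l) : has_concentrated_family ->
  l <o omega2 -> exists X, has_exact_height x X.
Proof.
move=> [f fc] /lt_omega2_inj[j jinj].
elim/(well_founded_ind (@Olt_wf l)): x => x IH.
have /choice[Y YP] (y : l) : exists X, Olt y x -> has_exact_height y X.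
  have [yx|nyx] := pselect (Olt y x); last by exists point_space.
  by have [X XP] := IH y yx; exists X.
have [[C [cC Cx Ccof]]|nC] := pselect (exists C : set l, [/\ countable C,
    C `<=` [set y | Olt y x] & forall y, Olt y x -> exists2 c, C c & Ole y c]).
  (* Countably many points are cofinal below [x]. Each of the corresponding
     spaces occurs infinitely often, so that it meets all balls of the hub. *)
  pose I : choiceType := (nat * {classic {c | C c}})%type.
  have CI (i : I) : Olt (sval i.2) x by case: i => k [c Cc]; exact: Cx.
  exists (hub_space (fun i : I => Y (sval i.2)) (fun (_ : unit) i => i.1)); split.
  - apply: hub_FLS => //.
    + by move=> [] [].
    + move=> h; apply: (@countable_sub _ _ setT) => //.
      rewrite -setXTT; apply: countableX; first exact: countableP.
      exact: countable_sig.
    + by move=> i; case: (YP _ (CI i)).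
  - exists (inl tt); apply: (@hub_in_CB _ x _ _ _ _ (fun i : I => sval i.2)).
      by move=> i; case: (YP _ (CI i)).
    move=> n y /Ccof[c Cc yc].
    by exists (n, exist _ c Cc : {classic {c | C c}}).
  - apply: (@hub_derived_CB _ x _ _ _ _ (fun i : I => sval i.2)) => // i.
    by case: (YP _ (CI i)).
have bd (C : set l) : countable C -> C `<=` [set y | Olt y x] ->
    exists2 y, Olt y x & forall c, C c -> Olt c y.
  move=> cC Cx; apply: contrapT => ny; apply: nC; exists C; split=> // y yx.
  apply: contrapT => nc; apply: ny; exists y => // c Cc; case: (OleP y c) => // yc.
  by exfalso; apply: nc; exists c.
have [y0 y0x _] : exists2 y, Olt y x & forall c, set0 c -> Olt c y by apply: bd.
(* No countable set is cofinal below [x], so [b] can be chosen to tend to [x]: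
   any bound below [x] is exceeded from some index on. *)
have /choice[b bP] (xi : omega1) : exists y, Olt y x /\
    forall z, Olt z x -> Ole (j z) xi -> Olt z y.
  have [||y yx yP] := bd [set z | Olt z x /\ Ole (j z) xi].
  - apply: (@countable_preimage _ _ j _ _ _ _ (omega1_countable_le xi)).
      by move=> y z _ _ /jinj.
    by move=> z [].
  - by move=> z [].
  - by exists y; split=> // z zx jz; exact: yP.
pose I : choiceType := ({classic omega1} + seq nat * nat)%type.
pose be (i : I) := if i is inl xi then b xi else y0.
have bex i : Olt (be i) x by case: i => [xi|//]; case: (bP xi).
exists (hub_space (fun i : I => Y (be i)) (branch_rank f)); split.
- apply: hub_FLS.
  + exact: countableP.
  + exact: branch_rank_separated.
  + exact: branch_rank_concentrated.
  + by move=> i; case: (YP _ (bex i)).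
- suff [d dP] : exists d, forall n z, Olt z x ->
      exists2 i, (n <= branch_rank f d i)%N & Ole z (be i).
    exists (inl d); apply: (@hub_in_CB _ x _ _ _ _ be) => // i.
    by case: (YP _ (bex i)).
  (* If every hub had a ball whose summands have indices bounded below [x], then
     these bounds would have a common bound below [x]; but the balls omit only
     countably many summands. *)
  apply: contrapT => /forallNP nd.
  have /choice[h hP] (d : seq nat) : exists nz : nat * l, Olt nz.2 x /\
      forall i, (nz.1 <= branch_rank f d i)%N -> Olt (be i) nz.2.
    apply: contrapT => nnz; apply: (nd d) => n z zx; apply: contrapT => ni.
    apply: nnz; exists (n, z); split=> // i di; case: (OleP z (be i)) => // zi.
    by exfalso; apply: ni; exists i.
  have [||y yx hy] := bd (range (snd \o h)).
  + exact/countable_image/countableP.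
  + by move=> _ [d _ <-]; case: (hP d).
  have cJ := branch_rank_concentrated fc (fst \o h).
  apply: omega1_uncountable; apply: (@countable_sub _ _ ([set xi | Olt xi (j y)] `|`
    (inl : omega1 -> I) @^-1` [set i | forall d, (branch_rank f d i < (fst \o h) d)%N])).
    move=> xi _; case: (OleP (j y) xi) => [jxi|]; [right=> d /=|by left].
    rewrite ltnNge; apply/negP => /((hP d).2 (inl xi)) /= bxi.
    apply: (@Olt_irr _ y); apply: Olt_trans ((bP xi).2 y yx jxi) _.
    by apply: Olt_trans bxi (hy _ _); exists d.
  apply: countableU; first exact: omega1_countable_lt.
  by apply: (@countable_preimage _ _ (inl : omega1 -> I) _ _ _ _ cJ) => // ? ? _ _ [].
- apply: (@hub_derived_CB _ x _ _ _ _ be) => // i.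
  by case: (YP _ (bex i)).
Qed.

Lemma cf_le (a b : Ord) (f : b -> a) :
  (forall x, exists i, Ole x (f i)) -> cf a <=o b.
Proof.
move=> fcof; have [|_] := @least_OrdP
  (fun k => exists f : k -> a, forall x, exists i, Ole x (f i)).
  by exists b, f.
by apply; exists f.
Qed.

Lemma cf_cofinal (a : Ord) : exists f : cf a -> a, forall x, exists i, Ole x (f i).
Proof.
have [|//] := @least_OrdP (fun k => exists f : k -> a, forall x, exists i, Ole x (f i)).
by exists a, id => x; exists x; exact: Ole_refl.
Qed.

(** Countably many cofinal heights are summed up, together with a space of
    height 2 for uncountability. *)
Lemma height_exists (l : Ord) : has_concentrated_family ->
  Onat 2 <=o l -> l <o omega2 -> cf l <=o omega ->
  exists X : topologicalType,
    [/\ ~ countable [set: X], FLS X & scattered_height X =o l].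
Proof.
move=> hc l2 lw cfl; have [f fc] := hc.
have /choice[Y YP] := fun x : l => exact_height_exists x hc lw.
have [e ecof] := cf_cofinal l.
have cC : countable (range e).
  apply: countable_image; have [g ginj] := Ordle_inj cfl.
  by apply: (@countable_preimage _ nat g setT setT) => // x y _ _ /ginj.
pose I : choiceType := option {classic {c | range e c}}.
pose Z := hub_space (fun=> point_space) (branch_rank f) : topologicalType.
pose W (i : I) : topologicalType := if i is Some c then Y (sval c) else Z.
have WFLS i : FLS (W i).
  by case: i => [[c ?]|]; [case: (YP c)|exact: height_two_FLS].
pose X := hub_space W (fun (_ : void) _ => 0%N) : topologicalType.
pose sp i (y : W i) : X := spoke (fun (_ : void) _ => 0%N) y.
exists X; split.
- move=> cX; apply: (height_two_uncountable (f := f)).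
  apply: (@countable_preimage _ _ (sp None) _ _ _ _ cX) => // y z _ _.
  exact: spoke_inj.
- apply: hub_FLS => // h; apply: (@countable_sub _ _ setT) => //.
  have -> : [set: I] = [set None] `|` Some @` setT.
    by apply/seteqP; split=> // -[c|] _; [right; exists c|left].
  by apply: countableU => //; apply: countable_image; exact: countable_sig.
apply: scattered_height_eq => [x|].
  have [i xi] := ecof x.
  have [_ [w wi] _] := YP (e i).
  have ei : range e (e i) by exists i.
  pose c : I := Some (exist _ (e i) ei : {classic {c | range e c}}).
  exists (sp c w); apply: (CB_at_le xi); have : CB_at (W c) (e i) w by [].
  by rewrite -(CB_at_spoke W (fun (_ : void) _ => 0%N)).
have CBW i (y : W i) : CB X l (sp i y) -> CB (W i) l y.
  move=> Xy z _; rewrite -(CB_at_spoke W (fun (_ : void) _ => 0%N)).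
  by rewrite -derived_set_spoke; exact: Xy.
rewrite -subset0 => -[[]|[[[c cr]|] y]] /CBW.
- by move=> /(_ c Logic.I); have [_ _ ->] := YP c.
- by rewrite (CB_ge2 l2 (height_two_derived2 f)).
Qed.

(** * Heights with limit part [omega1] *)

Lemma limit_omega1 : limit_Ord omega1.
Proof.
by move=> x; have [y yP] := omega1_bounded (countable1 x); exists y; exact: yP.
Qed.

(** A limit part smaller than [omega1] would be countable, as would be its sum
    with a finite ordinal. *)
Lemma lim_omega1S (a : Ord) : a =o Oadd omega1 (Onat 1) -> lim_Ord a =o omega1.
Proof.
move=> aw; have [|[mlim [n mn]] mmin] := @least_OrdP
    (fun m => limit_Ord m /\ exists n, a =o Oadd m (Onat n)).
  by exists omega1; split; [exact: limit_omega1|exists 1%N].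
rewrite -/(lim_Ord a) in mlim mn mmin.
apply: Ordle_anti.
  by apply: mmin; split; [exact: limit_omega1|exists 1%N].
apply: omega1_min => cm; apply: omega1_uncountable.
have cmn : countable [set: Oadd (lim_Ord a) (Onat n)].
  apply: countable_sum; first exact: countable_sub cm.
  exact: (@countableP 'I_n).
have [f _ fm] := Oeq_trans (Oeq_sym aw) mn.
apply: (@countable_preimage _ _ (fun x : omega1 => f (inl x)) _ _ _ _ cmn) => //.
by move=> x y _ _ /(mono_Oinj fm)[].
Qed.

Lemma cf_eq_omega1 (a : Ord) : a =o omega1 -> cf a =o omega1.
Proof.
move=> [g [g' gK g'K] gm]; apply: Ordle_anti.
  by apply: (@cf_le _ _ g') => x; exists (g x); rewrite gK; exact: Ole_refl.
have [f fcof] := cf_cofinal a; apply: omega1_min => cc.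
have [x xP] := omega1_bounded (countable_image (g \o f) cc).
have [i] := fcof (g' x); rewrite -gm g'K OleNgt => /negP; apply.
by apply: xP; exists i.
Qed.

(** Taking successors injects [omega1] into itself and misses the least
    point. *)
Lemma omega1S_lt_omega2 : Oadd omega1 (Onat 1) <o omega2.
Proof.
apply/lt_omega2_inj.
have /choice[S SP] (x : omega1) : exists y, Olt x y /\ forall z, Olt x z -> Ole y z.
  by apply: Ole_min; exact: limit_omega1.
have [z0 z0P] : exists z : omega1, forall y, Ole z y.
  have [y yP] := omega1_bounded (@countable0 omega1).
  have [|z [_ zmin]] := @Ole_min omega1 (fun=> True); first by exists y.
  by exists z => ? ; exact: zmin.
have Sz0 x : S x <> z0.
  by move=> Sx; have := (SP x).1; rewrite Sx /Olt z0P.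
have Slt x y : Olt x y -> S x <> S y.
  by move=> xy Sxy; have := (SP y).1; rewrite -Sxy /Olt ((SP x).2 _ xy).
exists (fun u : Oadd omega1 (Onat 1) => if u is inl x then S x else z0).
move=> [x|x] [y|y].
- move=> Sxy; congr inl; case: (OleP x y) => [/Ole_eqVlt[//|/Slt//]|/Slt].
  by rewrite Sxy.
- by move=> /Sz0.
- by move=> /esym/Sz0.
- by rewrite (ord1 x) (ord1 y).
Qed.

Lemma omega1_height_hyps : let l := Oadd omega1 (Onat 1) in
  [/\ Onat 2 <=o l, cf l <=o omega & cf (lim_Ord l) =o omega1].
Proof.
move=> l; split.
- apply: (@Ordle_trans omega1).
    by left; apply: countable_lt_omega1; exact: (@countableP 'I_2).
  by apply/Ordle_mono; exists inl.
- apply: (@Ordle_trans (Onat 1)).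
    apply: (@cf_le l (Onat 1) inr) => -[x|x]; exists ord0 => //=.
    by rewrite (ord1 x).
  by apply/Ordle_mono; exists (fun i : Onat 1 => nat_of_ord i).
- exact/cf_eq_omega1/lim_omega1S/Oeq_refl.
Qed.

Theorem corollary5p13 (R : realType) :
  [<->
    bounding_number =o omega1;
    exists A : set R, ~ countable A /\ Q_concentrated A;
    exists L : set {ptws nat -> nat}, ~ countable L /\ K_Lusin L;
    forall l : Ord, Onat 2 <=o l -> l <o omega2 ->
      cf l <=o omega -> cf (lim_Ord l) <=o omega1 ->
      exists X : topologicalType,
        [/\ ~ countable [set: X], FLS X & scattered_height X =o l];
    exists X : topologicalType,
      [/\ ~ countable [set: X], FLS X &
          exists n : nat, scattered_height X =o Onat n];
    exists X : topologicalType,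
      FLS X /\ cf (lim_Ord (scattered_height X)) =o omega1;
    exists X : topologicalType,
      [/\ semiregular X, ~ countable [set: X], FLS X &
          scattered_height X =o Onat 2]
  ].
Proof.
have semireg : has_concentrated_family -> exists X : topologicalType,
    [/\ semiregular X, ~ countable [set: X], FLS X & scattered_height X =o Onat 2].
  move=> [f fc]; exists (hub_space (fun=> point_space) (branch_rank f)); split.
  - exact: height_two_semiregular.
  - exact: height_two_uncountable.
  - exact: height_two_FLS.
  - exact: height_two_height.
have fin_conc : (exists X : topologicalType, [/\ ~ countable [set: X], FLS X &
    exists n : nat, scattered_height X =o Onat n]) -> has_concentrated_family.
  by move=> [X [nX fX [n hn]]]; exact: concentrated_of_finite_height hn.
have [l2 cfl limw] := omega1_height_hyps; have lw := omega1S_lt_omega2.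
have omega1_height (X : topologicalType) :
    scattered_height X =o Oadd omega1 (Onat 1) ->
    cf (lim_Ord (scattered_height X)) =o omega1.
  by move=> hX; exact/cf_eq_omega1/lim_omega1S.
tfae.
- by move=> /concentrated_of_bounding; exact: Q_concentrated_of_concentrated.
- move=> [A [nA QA]]; apply: Lusin_of_concentrated.
  exact: concentrated_of_Q_concentrated nA QA.
- move=> [L [nL KL]] l l2' lw' cfl' _.
  exact: height_exists (concentrated_of_Lusin nL KL) l2' lw' cfl'.
- move=> /(_ _ l2 lw cfl (Oeq_Ordle limw))[X [_ fX /omega1_height hX]].
  have [Z [_ nZ fZ hZ]] := semireg (concentrated_of_cf_height fX hX).
  by exists Z; split=> //; exists 2%N.
- move=> /fin_conc hc.
  have [X [_ fX /omega1_height hX]] := height_exists hc l2 lw cfl.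
  by exists X.
- by move=> [X [fX hX]]; apply: semireg; exact: concentrated_of_cf_height hX.
- move=> [X [_ nX fX hX]]; apply: bounding_of_concentrated; apply: fin_conc.
  by exists X; split=> //; exists 2%N.
Qed.
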